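(* Let $B=\{b_1,\dots,b_7\}\subset\mathbb{R}^2$ be a nonconfluent configuration of seven non-zero vectors in the plane (so $\sum_{i=1}^7 b_i=0$). Assume moreover that no line contains all but two of the vectors, i.e. no line through the origin contains five or more of the seven vectors. Then exactly one of the following holds: a) $B$ contains a non-splitting unbalanced cocircuit. b) $B$ is irreducible and all its cocircuits are balanced, in which case $B$ is $GL(2,\mathbb{R})$-equivalent to a regular heptagon. c) $B$ is a reducible configuration of the form $B=B_1\cup B_2\cup B_3$ or $B=B_1\cup B_2$ with each $B_i$ a cocircuit of $B$. d) $B$ is a reducible configuration of the form $B=B_1\cup B_2\cup B_3$, with one $B_i$ having three vectors which generate $\mathbb{R}^2$. e) $B$ is a reducible configuration of the form $B=B_1\cup B_2$, where $B_1$ is a pair of opposite vectors and $B_2$ is $GL(2,\mathbb{R})$-equivalent to a regular pentagon.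
   Context: A configuration $B=\{b_1,\dots,b_n\}\subset\mathbb{R}^2$ is a finite indexed family of vectors (repetitions allowed); ''line'' means a one-dimensional linear subspace. $B$ is nonconfluent if $\sum_i b_i=0$. For non-zero vectors, a subfamily $B(J)=\{b_j: j\in J\}$, $J\ne\emptyset$, is a cocircuit of $B$ if it consists of all vectors of $B$ lying on one and the same line through the origin. A cocircuit $B(J)$ is balanced if for some (equivalently, all) $j\in J$ the multiset $\{\det(b_i,b_j): i\notin J\}$ is symmetric around the origin (invariant, with multiplicities, under multiplication by $-1$); otherwise it is unbalanced. A cocircuit $B(J)$ is splitting if $\sum_{j\in J}b_j=0$, and non-splitting otherwise. $B$ is irreducible if it cannot be written as a disjoint union $B=B_1\cup B_2$ of two proper nonconfluent subconfigurations; otherwise it is reducible. Convention: whenever $B$ is written as a union of subconfigurations $B_i$, the union is disjoint (a partition of the index set) and each $B_i$ is a proper, nonempty, nonconfluent subconfiguration (so the vectors of each $B_i$ sum to zero). Two configurations are $GL(2,\mathbb{R})$-equivalent if some $g\in GL(2,\mathbb{R})$ carries one to the other up to reordering. A regular $k$-gon is the configuration of the $k$ vertices of a regular $k$-gon centered at the origin. *)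

(* Defs.v *)
From mathcomp Require Import all_boot all_order all_algebra.
From mathcomp Require Import reals trigo.

Set Implicit Arguments.
Unset Strict Implicit.
Unset Printing Implicit Defensive.

Import Order.TTheory GRing.Theory Num.Theory.
Local Open Scope ring_scope.

(* exists! forbids two true entries, at whatever positions they occur;
   positions beyond the end of Ps hold the default False. *)
Definition exactly_one (Ps : seq Prop) : Prop := exists! i : nat, nth False Ps i.

Section Configurations.

Variable R : realType.

Definition vdet (u v : 'cV[R]_2) : R := \det (row_mx u v : 'M[R]_2).

(* One of the maps u |-> g *m u carries s to t, up to reordering. *)
Definition GL2_equiv (s t : seq 'cV[R]_2) : Prop :=
  exists2 g : 'M[R]_2, g \in unitmx & perm_eq [seq g *m u | u <- s] t.

(* The vertices of the regular k-gon centered at the origin with circumradius r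
   and first vertex at angle t. *)
Definition regular_polygon (k : nat) (r t : R) : seq 'cV[R]_2 :=
  [seq \col_(c < 2) (r * (if c == ord0 then cos (t + 2 * pi * m%:R / k%:R)
                          else sin (t + 2 * pi * m%:R / k%:R)))
     | m <- iota 0 k].

Definition equiv_regular_polygon (k : nat) (s : seq 'cV[R]_2) : Prop :=
  exists r t : R, 0 < r /\ GL2_equiv s (regular_polygon k r t).

Variable n : nat.

(* A configuration is a family b; a subconfiguration is given by the set
   J of its indices, so that repeated vectors are kept apart. *)
Implicit Types (b : 'I_n -> 'cV[R]_2) (J : {set 'I_n}) (P : {set {set 'I_n}}).

Definition nonconfluent b J : Prop := \sum_(j in J) b j = 0.

Definition on_line b (L : {vspace 'cV[R]_2}) : {set 'I_n} :=
  [set j | b j \in L].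

Definition cocircuit b J : Prop :=
  J != set0 /\
  exists L : {vspace 'cV[R]_2}, \dim L = 1%N /\ J = on_line b L.

Definition balanced b J : Prop :=
  exists2 j, j \in J &
    perm_eq [seq vdet (b i) (b j) | i in ~: J]
            [seq - vdet (b i) (b j) | i in ~: J].

Definition splitting b J : Prop := \sum_(j in J) b j = 0.

(* finset's partition already requires the blocks to be nonempty. *)
Definition decomposition b P : Prop :=
  partition P [set: 'I_n] /\
  forall J, J \in P -> J \proper [set: 'I_n] /\ nonconfluent b J.

Definition reducible b : Prop := exists P, decomposition b P /\ #|P| = 2%N.

Definition irreducible b : Prop := ~ reducible b.

Definition opposite_pair b J : Prop :=
  exists i j, [/\ i != j, J = [set i; j] & b i = - b j].

Definition generates b J : Prop := <<[seq b j | j in J]>>%VS = fullv.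

End Configurations.

(* Main.v *)
Require Import Defs.
From mathcomp Require Import all_boot all_order all_algebra.
From mathcomp Require Import reals trigo boolp.
From mathcomp Require Import ring lra zify.

Set Implicit Arguments.
Unset Strict Implicit.
Unset Printing Implicit Defensive.

Import Order.TTheory GRing.Theory Num.Theory.
Local Open Scope ring_scope.

(** Let P_k(u) be the sum of det(v, u)^k over the seven vectors v.  The first
    alternative fails exactly when every line spanned by a vector u of the
    configuration is splitting, or is balanced, which makes P_k(u) vanish for
    all odd k.  But P_k is a binary form of degree k, so it is identically zero
    as soon as more than k lines are balanced; then all moments
    sum x^j y^(k-j) of the configuration vanish, in every coordinate system
    ([moment_eq0]).  The whole classification rests on the forms P_1, P_3, P_5.

    A pair of opposite vectors contributes nothing to an odd power sum and
    nothing to the sum of a line, so such pairs can be taken away.  If two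
    disjoint pairs are found, the other three vectors sum to zero, and they
    either span the plane (a triangle and two pairs) or lie on one line (lines
    that all split).  Otherwise five or seven vectors without opposite pair
    remain, and apart from a splitting 4 + 3 arrangement they all lie on
    distinct lines ([five_nonpar], [seven_nonpar]).  Indeed the complement of a
    balanced line has even size, which leaves lines of one, three or four
    vectors; and three numbers whose cubes sum to the cube of their sum include
    two opposite ones, which turns the vanishing of P_1 and P_3 at a line of
    one vector into an opposite pair on a line of three.  Only the arrangement
    3 + 1 + 1 + 1 + 1 needs the fifth powers ([pentagon_triple]).

    Suppose finally that n = 5 or n = 7 vectors lie on distinct lines, all
    balanced.  With u among them as the point (0, 1), balancedness at u groups
    the others in pairs of abscissae x and -x.  The moments x^2 y and x y^2,
    with x^4 y and x^3 y^2 for n = 7, force, after a shear fixing u, equal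
    ordinates inside each pair: the configuration has a linear reflection
    fixing u.  The ordinates A_1, A_2, ... of the pairs satisfy
    1 + 2 (A_1^k + A_2^k + ...) = 0 for odd k <= n - 2, whose
    only solution is A_m = cos(2 pi m / n), and the remaining moments make
    x_m^2 proportional to 1 - A_m^2 ([heptagon_form],
    [pentagon_form]).  The heptagon is irreducible because a zero sum
    u + a + b would make (a, b) a pair of ordinate -1/2, which is not a root of
    8 T^3 + 4 T^2 - 4 T - 1 ([heptagon_not_splits]).

    The alternatives exclude each other: all lines split in the third one, but
    not in the fourth and fifth, and in each of these three every line splits
    or is balanced; the last two differ because two disjoint opposite pairs
    beside a pentagon, whose vertices are on distinct lines, would put four
    vectors on a line that carries at most three
    ([pair_pentagon_not_two_pairs]).

    The argument is carried out on sequences of vectors up to permutation; the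
    index sets of the statement are reached by lifting a permuted sequence of
    blocks back to indices ([lift_blocks], [blocks_decomposition]). *)

(** [lra] looks for linear combinations with numeric coefficients; this supplies
    the multiple of an equation by a chosen polynomial factor. *)
Ltac mulby c h :=
  let H := fresh in have H := congr1 (fun z => c * z) h; cbv beta in H; move: H.

(** * Determinants in the plane *)

Section Determinant.

Variable R : realType.
Local Notation V := 'cV[R]_2.
Implicit Types (u v w : V) (s : seq V).

Lemma vdetE u v :
  vdet u v = u ord0 ord0 * v ord_max ord0 - u ord_max ord0 * v ord0 ord0.
Proof.
rewrite /vdet (expand_det_row _ ord0) big_ord_recl big_ord1 /cofactor.
rewrite !det_mx11 !mxE.
have splitE (i : 'I_2) : split (i : 'I_(1 + 1)) = if i == ord0 then inl ord0 else inr ord0.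
  by case: splitP => k; rewrite (ord1 k) -val_eqE /= => ->.
rewrite !splitE /= expr0 expr1 (ord1 0).
rewrite (_ : lift ord0 ord0 = ord_max); last exact/val_inj.
by ring.
Qed.

Lemma col2P u v : u ord0 ord0 = v ord0 ord0 -> u ord_max ord0 = v ord_max ord0 -> u = v.
Proof.
move=> h0 h1; apply/colP => i.
have [->|->] : i = ord0 \/ i = ord_max; last 2 first.
- exact: h0.
- exact: h1.
by case: i => [[|[|//]] ?]; [left|right]; apply/val_inj.
Qed.

Lemma vdetDl u v w : vdet (u + v) w = vdet u w + vdet v w.
Proof. by rewrite !vdetE !mxE; ring. Qed.

Lemma vdetNl u w : vdet (- u) w = - vdet u w.
Proof. by rewrite !vdetE !mxE; ring. Qed.

Lemma vdetZl a u w : vdet (a *: u) w = a * vdet u w.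
Proof. by rewrite !vdetE !mxE; ring. Qed.

Lemma vdet0l w : vdet 0 w = 0.
Proof. by rewrite !vdetE !mxE; ring. Qed.

Lemma vdetC u v : vdet u v = - vdet v u.
Proof. by rewrite !vdetE; ring. Qed.

Lemma vdetvv u : vdet u u = 0.
Proof. by rewrite !vdetE; ring. Qed.

Lemma vdetDr u v w : vdet w (u + v) = vdet w u + vdet w v.
Proof. by rewrite !vdetE !mxE; ring. Qed.

Lemma vdetZr a u w : vdet w (a *: u) = a * vdet w u.
Proof. by rewrite !vdetE !mxE; ring. Qed.

Lemma vdet_suml (I : Type) (r : seq I) (P : pred I) (f : I -> V) w :
  vdet (\sum_(i <- r | P i) f i) w = \sum_(i <- r | P i) vdet (f i) w.
Proof.
apply: (big_morph (fun v => vdet v w)); first by move=> u v; exact: vdetDl.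
exact: vdet0l.
Qed.

(** Cramer's rule written without division, so that it also covers dependent u and v. *)
Lemma cramer u v w : vdet u v *: w = vdet w v *: u + vdet u w *: v.
Proof. by apply: col2P; rewrite !mxE !vdetE; ring. Qed.

Lemma plucker u v w z :
  vdet u v * vdet w z = vdet w v * vdet u z + vdet u w * vdet v z.
Proof. by rewrite !vdetE; ring. Qed.

Lemma vdet_eq0 u w1 w2 : vdet w1 w2 != 0 -> vdet u w1 = 0 -> vdet u w2 = 0 -> u = 0.
Proof.
move=> h h1 h2; apply/eqP; have := cramer w1 w2 u.
rewrite (vdetC w1 u) h1 h2 oppr0 !scale0r addr0 => /eqP.
by rewrite scaler_eq0 (negPf h).
Qed.

Lemma par_scale u v : u != 0 -> vdet v u = 0 -> exists a, v = a *: u.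
Proof.
move=> u0 h.
have [w hw] : exists w, vdet u w != 0.
  have [h0|h0] := eqVneq (u ord0 ord0) 0.
    exists (\col_i (i == ord0)%:R); rewrite vdetE !mxE /= h0 mul0r sub0r mulr1 oppr_eq0.
    by apply: contra_neq u0 => h1; apply: col2P; rewrite !mxE.
  by exists (\col_i (i != ord0)%:R); rewrite vdetE !mxE /= mulr1 mulr0 subr0.
exists (vdet v w / vdet u w); apply: (scalerI hw).
rewrite scalerA mulrCA divff // mulr1 cramer.
by rewrite (vdetC u) h oppr0 scale0r addr0.
Qed.

Lemma par_trans v u w : v != 0 -> vdet u v = 0 -> vdet v w = 0 -> vdet u w = 0.
Proof. by move=> v0 /(par_scale v0)[a ->] h; rewrite vdetZl h mulr0. Qed.

Lemma exists_dual u : u != 0 -> exists w, vdet u w = 1.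
Proof.
move=> u0.
have [w hw] : exists w, vdet u w != 0.
  apply: contrapT => /forallNP h; move: u0 => /negP; apply.
  have /(_ _) hh w : vdet u w = 0 by apply/eqP; apply: contrapT => /negP; exact: h.
  apply/eqP; apply: (@vdet_eq0 _ (\col_i (i == ord0)%:R) (\col_i (i != ord0)%:R)) => //.
  by rewrite vdetE !mxE /=; rewrite mulr1 mulr0 subr0 oner_eq0.
by exists ((vdet u w)^-1 *: w); rewrite vdetZr mulVf.
Qed.

End Determinant.

(** * Odd power sums and vanishing moments *)

Section Moments.

Variable R : realType.
Local Notation V := 'cV[R]_2.
Implicit Types (u v w : V) (s : seq V).

(** A boolean on sequences: distinct entries are on distinct lines and, since
    det(u, u) = 0, no vector is repeated. *)
Definition nonpar s : bool := pairwise (fun u v => vdet u v != 0) s.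

Definition psum s k u : R := \sum_(v <- s) vdet v u ^+ k.

Lemma perm_psum s t k u : perm_eq s t -> psum s k u = psum t k u.
Proof. by move=> st; rewrite /psum (perm_big _ st). Qed.

Lemma psum1 s u : psum s 1 u = vdet (\sum_(v <- s) v) u.
Proof. by rewrite vdet_suml; apply: eq_bigr. Qed.

(** On the affine line w + t z of directions, the form P_k becomes a polynomial
    in t whose coefficients are the moments of the configuration in the
    coordinates det(-, z), det(-, w), up to binomial factors.  Vanishing at z
    lowers its degree below k, and the k other directions give k distinct
    roots.  The vector w is arbitrary, which later allows a shear to be applied
    before the moments are read off. *)
Lemma moment_eq0 s k (z : V) (us : seq V) : nonpar (z :: us) ->
    (k <= size us)%N -> {in z :: us, forall u, psum s k u = 0} ->
  forall w j, vdet w z != 0 -> (j <= k)%N ->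
  \sum_(v <- s) vdet v z ^+ j * vdet v w ^+ (k - j) = 0.
Proof.
move=> /= /andP[/allP znp usnp] sz h w j wz0 jk.
pose p : {poly R} := \sum_(v <- s) ((vdet v w)%:P + vdet v z *: 'X) ^+ k.
have coefp i : p`_i = if (i <= k)%N then
    (\sum_(v <- s) vdet v z ^+ i * vdet v w ^+ (k - i)) *+ 'C(k, i) else 0.
  rewrite coef_sum; case: leqP => ik; last first.
    apply: big1 => v _; apply: nth_default; apply: leq_trans ik.
    apply: leq_trans (size_exp_leq _ _) _; rewrite ltnS.
    have : (size ((vdet v w)%:P + vdet v z *: 'X)%R <= 2)%N.
      rewrite (leq_trans (size_polyD _ _)) // geq_max (leq_trans (size_polyC_leq1 _)) //=.
      by rewrite (leq_trans (size_scale_leq _ _)) // size_polyX.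
    by case: (size _) => [|[|[|//]]]; rewrite ?mul0n ?mul1n.
  rewrite -sumrMnl; apply: eq_bigr => v _.
  rewrite exprDn coef_sum (bigD1 (Ordinal (ik : (i < k.+1)%N))) //= big1 => [|l /eqP li].
    rewrite addr0 coefMn exprZn -polyC_exp coefCM coefZ coefXn eqxx mulr1.
    by rewrite mulrC.
  rewrite coefMn exprZn -polyC_exp coefCM coefZ coefXn.
  case: eqP => [il|_]; last by rewrite !mulr0 mul0rn.
  by case: li; apply/val_inj.
(* The coefficient of degree k is P_k(z) = 0. *)
have sizep : (size p <= k)%N.
  apply/leq_sizeP => i; rewrite leq_eqVlt => /orP[/eqP <-|ki]; last by rewrite coefp leqNgt ki.
  rewrite coefp leqnn subnn.
  under eq_bigr do rewrite expr0 mulr1.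
  by rewrite -/(psum s k z) h ?mem_head // mul0rn.
(* A direction u is proportional to w + (rt u) z. *)
pose rt u := vdet w u / vdet u z.
have uz u : u \in us -> vdet u z != 0.
  by move=> /znp; rewrite vdetC oppr_eq0.
have p0 : p = 0.
  apply: (@roots_geq_poly_eq0 _ p [seq rt u | u <- us]); last by rewrite size_map (leq_trans sizep).
    apply/allP => _ /mapP[u uus ->]; apply/rootP.
    have : psum s k u = 0 by apply: h; rewrite in_cons uus orbT.
    move=> /(congr1 (fun x => x * (vdet w z / vdet u z) ^+ k)).
    rewrite mul0r /psum mulr_suml => <-.
    rewrite horner_sum; apply: eq_bigr => v _; rewrite -exprMn.
    rewrite horner_exp hornerD hornerC hornerZ hornerX.
    congr (_ ^+ _); rewrite /rt.
    have uz0 := uz u uus; rewrite !mulrA.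
    have -> : vdet v u * vdet w z = vdet v w * vdet u z + vdet v z * vdet w u.
      by have := plucker w z v u; rewrite (vdetC z u) (vdetC w v); lra.
    by field.
  elim: us {h p coefp sizep znp sz} usnp uz => //= u us IH /andP[/allP unp usnp] uz.
  rewrite IH //; last by move=> v vus; apply: uz; rewrite in_cons vus orbT.
  rewrite andbT; apply/mapP => -[v vus].
  have uz0 : vdet u z != 0 by apply: uz; rewrite mem_head.
  have vz0 : vdet v z != 0 by apply: uz; rewrite in_cons vus orbT.
  move/eqP; rewrite /rt eqr_div // => /eqP e.
  have /negP := unp _ vus; apply.
  suff : vdet w z * vdet u v = 0 by move=> /eqP; rewrite mulf_eq0 (negPf wz0).
  by rewrite plucker (vdetC z v) (vdetC u z); move: e; rewrite (vdetC z u); lra.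
have := coefp j; rewrite p0 coef0 jk => /esym/eqP.
by rewrite -mulr_natr mulf_eq0 pnatr_eq0 -leqn0 leqNgt bin_gt0 jk orbF => /eqP.
Qed.

End Moments.

(** * Multisets symmetric about the origin *)

Section Symmetric.

Variable R : realType.
Local Notation V := 'cV[R]_2.
Implicit Types (u v w : V) (s : seq V) (D : seq R).

Definition symm D : bool := perm_eq D [seq - t | t <- D].

Definition dets s u : seq R := [seq vdet v u | v <- s].

Lemma symm_perm D D' : perm_eq D D' -> symm D = symm D'.
Proof. by move=> h; rewrite /symm (permPl h) (permPr (perm_map _ h)). Qed.

Lemma perm_dets s s' u : perm_eq s s' -> perm_eq (dets s u) (dets s' u).
Proof. exact: perm_map. Qed.

Lemma symm_cons0 D : symm (0 :: D) = symm D.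
Proof. by rewrite /symm /= oppr0 perm_cons. Qed.

Lemma symm_cons2 t D : symm (t :: - t :: D) = symm D.
Proof.
rewrite /symm /= opprK.
rewrite (permPr (_ : perm_eq _ (t :: - t :: [seq - x | x <- D]))) ?perm_cons //.
by rewrite (perm_catCA [:: - t] [:: t]).
Qed.

Lemma symm_zeros D D' : all (pred1 0) D -> symm (D ++ D') = symm D'.
Proof. by elim: D => //= t D IH /andP[/eqP -> /IH <-]; rewrite symm_cons0. Qed.

Lemma symm_filter D : symm D = symm [seq t <- D | t != 0].
Proof.
have p := perm_filterC (fun t => t == 0) D.
by rewrite -(symm_perm (permEl p)) symm_zeros // filter_all.
Qed.

Lemma symm_odd_sum D k : symm D -> odd k -> \sum_(t <- D) t ^+ k = 0.
Proof.
move=> sD ok; have : \sum_(t <- D) t ^+ k = - \sum_(t <- D) t ^+ k.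
  rewrite {1}(perm_big _ sD) big_map -sumrN; apply: eq_bigr => t _.
  by rewrite exprNn -signr_odd ok mulN1r.
lra.
Qed.

Lemma symm_psum s u k : symm (dets s u) -> odd k -> psum s k u = 0.
Proof. by move=> sD ok; rewrite -(symm_odd_sum sD ok) big_map. Qed.

(** Negation exchanges the positive and the negative entries. *)
Lemma symm_even_size D : symm D -> 0 \notin D -> ~~ odd (size D).
Proof.
move=> sD D0.
have e : count (fun t => 0 < t) D = count (fun t => t < 0) D.
  rewrite (permP sD) count_map; apply: eq_count => t /=; exact: oppr_gt0.
rewrite -(count_predC (fun t => 0 < t)) {1}e addnC.
rewrite (_ : count _ D = count (fun t => t < 0) D).
  by rewrite addnn odd_double.
apply: eq_in_count => t tD /=; rewrite -leNgt le_eqVlt.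
by rewrite (_ : (t == 0) = false) //; apply: contraNF D0 => /eqP <-.
Qed.

Lemma symm_detsZ s u a : symm (dets s u) -> symm (dets s (a *: u)).
Proof.
move=> sD; have e : dets s (a *: u) = map ( *%R a) (dets s u).
  by rewrite -map_comp; apply: eq_map => v /=; rewrite vdetZr.
rewrite /symm e.
have -> : [seq - t | t <- map ( *%R a) (dets s u)] = map ( *%R a) [seq - t | t <- dets s u].
  by rewrite -!map_comp; apply: eq_map => t /=; rewrite mulrN.
exact: perm_map.
Qed.

(** The opposite of a nonzero determinant is realized by another vector; removing
    the two keeps the symmetry, so the vectors off a balanced line can be
    paired one pair at a time. *)
Lemma symm_split u v s : symm (dets (v :: s) u) -> vdet v u != 0 ->
  exists v' s', [/\ perm_eq s (v' :: s'), vdet v' u = - vdet v u & symm (dets s' u)].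
Proof.
move=> sD v0; have : - vdet v u \in dets (v :: s) u.
  by rewrite (perm_mem sD) mem_map ?mem_head //; exact: oppr_inj.
rewrite in_cons => /orP[/eqP e|/mapP[v' v's e]].
  by exfalso; move/eqP: v0; apply; lra.
exists v', (rem v' s); have p := perm_to_rem v's; split => //.
rewrite -(symm_cons2 (vdet v u)) e.
by rewrite -(@symm_perm (dets (v :: s) u)) //= perm_cons (perm_dets u p).
Qed.

End Symmetric.

(** * Algebraic identities behind the pentagon and the heptagon *)

Section Scalars.

Variable R : realType.
Implicit Types (a b c x y z : R).

(** The difference of the two sides is 3 (x + y) (x + z) (y + z). *)
Lemma cubes_sum x y z : x ^+ 3 + y ^+ 3 + z ^+ 3 = (x + y + z) ^+ 3 ->
  [\/ x + y = 0, x + z = 0 | y + z = 0].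
Proof.
move=> h; have /eqP : (x + y) * ((x + z) * (y + z)) = 0 by lra.
by rewrite !mulf_eq0 => /or3P[] /eqP; [constructor 1|constructor 2|constructor 3].
Qed.

(** If p = q, the two equations become a Vandermonde system for p, r with
    weights S1 + S2 and S3, whose total would vanish. *)
Lemma vandermonde_neq p q r (S1 S2 S3 : R) : r != 0 -> S1 + S2 + S3 != 0 -> p != 0 ->
  p * S1 + q * S2 + r * S3 = 0 -> p ^+ 2 * S1 + q ^+ 2 * S2 + r ^+ 2 * S3 = 0 -> p != q.
Proof.
move=> r0 S0 p0 h1 h2; apply/eqP => pq; subst q.
have /eqP : r * ((r - p) * S3) = 0 by mulby p h1; lra.
rewrite !mulf_eq0 (negPf r0) /= => /orP[/eqP e|/eqP e].
  have {}e : r = p by lra.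
  subst r; have /eqP : p * (S1 + S2 + S3) = 0 by lra.
  by rewrite mulf_eq0 (negPf p0) (negPf S0).
subst S3; have /eqP : p * (S1 + S2 + 0) = 0 by lra.
by rewrite mulf_eq0 (negPf p0) (negPf S0).
Qed.

(** The kernel of the 2 x 3 Vandermonde system is a line: both (T_i) and
    (T_i e_i) lie in it, so the factors e_i agree. *)
Lemma vandermonde_ker p q r (T1 T2 T3 e1 e2 e3 : R) : r != 0 -> q != r -> T3 != 0 ->
  p * T1 + q * T2 + r * T3 = 0 -> p ^+ 2 * T1 + q ^+ 2 * T2 + r ^+ 2 * T3 = 0 ->
  p * (T1 * e1) + q * (T2 * e2) + r * (T3 * e3) = 0 ->
  p ^+ 2 * (T1 * e1) + q ^+ 2 * (T2 * e2) + r ^+ 2 * (T3 * e3) = 0 -> e3 = e1.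
Proof.
move=> r0 qr T0 h1 h2 h3 h4.
have /eqP : r * ((r - q) * (T3 * (e3 - e1))) = 0.
  by mulby (q * e1) h1; mulby e1 h2; mulby q h3; lra.
rewrite !mulf_eq0 (negPf r0) (negPf T0) (subr_eq0 r) (eq_sym r) (negPf qr) /=.
by move=> /eqP; lra.
Qed.

(** For pairs with abscissae +-a, +-b, +-c, the S_i are the sums and the d_i the
    differences of the two ordinates.  The moments x^2 y and x^4 y place (S_i) in
    the kernel of a Vandermonde system in the squared abscissae, and the moments
    x y^2 and x^3 y^2 place (S_i d_i / x_i) in the same kernel.  The ordinates
    differ by a multiple of the abscissa, which a shear removes. *)
Lemma heptagon_shear a b c (S1 S2 S3 d1 d2 d3 : R) : a != 0 -> b != 0 -> c != 0 ->
    1 + S1 + S2 + S3 = 0 ->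
    a ^+ 2 * S1 + b ^+ 2 * S2 + c ^+ 2 * S3 = 0 ->
    a ^+ 4 * S1 + b ^+ 4 * S2 + c ^+ 4 * S3 = 0 ->
    a * S1 * d1 + b * S2 * d2 + c * S3 * d3 = 0 ->
    a ^+ 3 * S1 * d1 + b ^+ 3 * S2 * d2 + c ^+ 3 * S3 * d3 = 0 ->
  exists t, [/\ d1 = t * a, d2 = t * b & d3 = t * c].
Proof.
move=> a0 b0 c0 h0 h2 h4 g1 g3.
have [p0 q0 r0] : [/\ a ^+ 2 != 0, b ^+ 2 != 0 & c ^+ 2 != 0] by split; rewrite expf_neq0.
have S0 : S1 + S2 + S3 != 0 by apply/eqP; lra.
have pq : a ^+ 2 != b ^+ 2 by apply: (vandermonde_neq r0 S0 p0); lra.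
have rp : c ^+ 2 != a ^+ 2.
  apply: (@vandermonde_neq _ _ (b ^+ 2) S3 S1 S2) => //; lra.
have qr : b ^+ 2 != c ^+ 2.
  apply: (@vandermonde_neq _ _ (a ^+ 2) S2 S3 S1) => //; lra.
have S3n0 : S3 != 0.
  apply/eqP => e; subst S3; have /eqP : b ^+ 2 * ((b ^+ 2 - a ^+ 2) * S2) = 0.
    by mulby (a ^+ 2) h2; lra.
  rewrite mulf_eq0 (negPf q0) mulf_eq0 subr_eq0 (eq_sym (b ^+ 2)) (negPf pq) /= => /eqP e.
  subst S2; have /eqP : a ^+ 2 * S1 = 0 by lra.
  by rewrite mulf_eq0 (negPf p0) /= => /eqP; lra.
have S2n0 : S2 != 0.
  apply/eqP => e; subst S2; have /eqP : c ^+ 2 * ((c ^+ 2 - a ^+ 2) * S3) = 0.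
    by mulby (a ^+ 2) h2; lra.
  by rewrite mulf_eq0 (negPf r0) mulf_eq0 subr_eq0 (negPf rp) (negPf S3n0).
have h4' : (a ^+ 2) ^+ 2 * S1 + (b ^+ 2) ^+ 2 * S2 + (c ^+ 2) ^+ 2 * S3 = 0 by rewrite -!exprM.
have g1' : a ^+ 2 * (S1 * (d1 / a)) + b ^+ 2 * (S2 * (d2 / b)) + c ^+ 2 * (S3 * (d3 / c)) = 0.
  by rewrite -[RHS]g1; field; rewrite a0 b0 c0.
have g3' : (a ^+ 2) ^+ 2 * (S1 * (d1 / a)) + (b ^+ 2) ^+ 2 * (S2 * (d2 / b))
    + (c ^+ 2) ^+ 2 * (S3 * (d3 / c)) = 0.
  by rewrite -[RHS]g3; field; rewrite a0 b0 c0.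
exists (d1 / a); split; first by field.
  have <- : d2 / b = d1 / a; last by field.
  apply: (@vandermonde_ker (a ^+ 2) (c ^+ 2) (b ^+ 2) S1 S3 S2 _ (d3 / c)) => //; rewrite 1?eq_sym // addrAC //.
have <- : d3 / c = d1 / a; last by field.
exact: (@vandermonde_ker (a ^+ 2) (b ^+ 2) (c ^+ 2) S1 S2 S3 _ (d2 / b)).
Qed.

(** The defects e1^3 - p3 and e1^5 - p5 of power sums are both divisible by
    (A + B) (B + C) (C + A); dividing them determines the elementary symmetric
    functions one after the other. *)
Lemma heptagon_values (A B C : R) :
    1 + 2 * (A + B + C) = 0 -> 1 + 2 * (A ^+ 3 + B ^+ 3 + C ^+ 3) = 0 ->
    1 + 2 * (A ^+ 5 + B ^+ 5 + C ^+ 5) = 0 ->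
  [/\ A + B + C = - 2^-1, A * B + B * C + C * A = - 2^-1 & A * B * C = 8^-1].
Proof.
move=> h1 h3 h5; have eC : C = - 2^-1 - A - B by lra.
have g3 : (A + B) * (B + C) * (C + A) = 8^-1 by rewrite eC in h3 *; lra.
have g5 : (A + B) * (B + C) * (C + A) * (A ^+ 2 + B ^+ 2 + C ^+ 2 + A * B + B * C + C * A) = 3 / 32.
  by clear g3; rewrite eC in h5 *; lra.
rewrite g3 in g5.
have e2 : A * B + B * C + C * A = - 2^-1 by rewrite eC in g5 *; lra.
split => //; first lra.
by rewrite eC in g3 e2 *; lra.
Qed.

Lemma pair_roots (B C p q : R) : B + C = p + q -> B * C = p * q ->
  (B = p /\ C = q) \/ (B = q /\ C = p).
Proof.
move=> h1 h2; have /eqP : (B - p) * (B - q) = 0 by mulby B h1; lra.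
by rewrite mulf_eq0 !subr_eq0 => /orP[] /eqP e; subst B; [left|right]; split => //; lra.
Qed.

(** Both triples are the roots of one monic cubic. *)
Lemma cubic_roots (A B C p q r : R) :
    A + B + C = p + q + r -> A * B + B * C + C * A = p * q + q * r + r * p ->
    A * B * C = p * q * r ->
  perm_eq [:: A; B; C] [:: p; q; r].
Proof.
wlog : p q r / A = p.
  move=> H h1 h2 h3; have /eqP : (A - p) * ((A - q) * (A - r)) = 0.
    by mulby (A ^+ 2) h1; mulby A h2; lra.
  rewrite !mulf_eq0 !subr_eq0 => /or3P[] /eqP e; first exact: H.
    have -> : perm_eq [:: A; B; C] [:: p; q; r] = perm_eq [:: A; B; C] [:: q; r; p].
      by apply: permPr; exact: (permEl (perm_catC [:: p] [:: q; r])).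
    by apply: H => //; lra.
  have -> : perm_eq [:: A; B; C] [:: p; q; r] = perm_eq [:: A; B; C] [:: r; p; q].
    by apply: permPr; exact: (permEl (perm_catC [:: p; q] [:: r])).
  by apply: H => //; lra.
move=> -> h1 h2 h3; rewrite perm_cons.
have s : B + C = q + r by lra.
have m : B * C = q * r by mulby p s; lra.
by have [[-> ->]|[-> ->]] := pair_roots s m => //; rewrite (perm_catC [:: r]).
Qed.

(** The hypotheses on c_i say that they are the roots of
    8 T^3 + 4 T^2 - 4 T - 1.  The vectors (p, q, r) and (1 - c_i^2) are both
    orthogonal to (c_i) and (c_i^3), which are independent because the c_i are
    nonzero with distinct squares. *)
Lemma heptagon_squares (c1 c2 c3 p q r : R) : c1 ^+ 2 != 1 ->
    c1 + c2 + c3 = - 2^-1 -> c1 * c2 + c2 * c3 + c3 * c1 = - 2^-1 -> c1 * c2 * c3 = 8^-1 ->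
    p * c1 + q * c2 + r * c3 = 0 -> p * c1 ^+ 3 + q * c2 ^+ 3 + r * c3 ^+ 3 = 0 ->
  exists l, [/\ p = l * (1 - c1 ^+ 2), q = l * (1 - c2 ^+ 2) & r = l * (1 - c3 ^+ 2)].
Proof.
move=> c11 s1 s2 s3 h1 h3.
have ec3 : c3 = - 2^-1 - c1 - c2 by lra.
(* The discriminant of the cubic, which shows that its roots are distinct. *)
have disc : (c1 - c2) ^+ 2 * ((c2 - c3) ^+ 2 * (c3 - c1) ^+ 2) = 49 / 64.
  have -> : (c1 - c2) ^+ 2 * ((c2 - c3) ^+ 2 * (c3 - c1) ^+ 2) =
    (c1 + c2 + c3) ^+ 2 * (c1 * c2 + c2 * c3 + c3 * c1) ^+ 2
     - 4 * (c1 * c2 + c2 * c3 + c3 * c1) ^+ 3 - 4 * (c1 + c2 + c3) ^+ 3 * (c1 * c2 * c3)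
     + 18 * (c1 + c2 + c3) * (c1 * c2 + c2 * c3 + c3 * c1) * (c1 * c2 * c3)
     - 27 * (c1 * c2 * c3) ^+ 2 by ring.
  by rewrite s1 s2 s3; lra.
have c0 : [/\ c1 != 0, c2 != 0 & c3 != 0].
  by split; apply/eqP => e; rewrite e in s3; lra.
have [c10 c20 c30] := c0.
have d23 : c2 - c3 != 0 by apply/eqP => e; rewrite e in disc; lra.
have a23 : c2 + c3 != 0.
  apply/eqP => e; have {}e : c3 = - c2 by lra.
  rewrite e in s1 s2 s3; have e1 : c1 = - 2^-1 by lra.
  by rewrite e1 in s2 s3; lra.
have k0 : 1 - c1 ^+ 2 != 0 by rewrite subr_eq0 eq_sym.
set l := p / (1 - c1 ^+ 2).
have lp : p = l * (1 - c1 ^+ 2) by rewrite /l mulfVK.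
have z1 : (1 - c1 ^+ 2) * c1 + (1 - c2 ^+ 2) * c2 + (1 - c3 ^+ 2) * c3 = 0.
  have : (c1 + c2) * (c2 + c3) * (c3 + c1) = 8^-1.
    have -> : (c1 + c2) * (c2 + c3) * (c3 + c1) =
      (c1 + c2 + c3) * (c1 * c2 + c2 * c3 + c3 * c1) - c1 * c2 * c3 by ring.
    by rewrite s1 s2 s3; lra.
  by rewrite ec3; lra.
have z3 : (1 - c1 ^+ 2) * c1 ^+ 3 + (1 - c2 ^+ 2) * c2 ^+ 3 + (1 - c3 ^+ 2) * c3 ^+ 3 = 0.
  have -> : (1 - c1 ^+ 2) * c1 ^+ 3 + (1 - c2 ^+ 2) * c2 ^+ 3 + (1 - c3 ^+ 2) * c3 ^+ 3 =
    let e1 := c1 + c2 + c3 in let e2 := c1 * c2 + c2 * c3 + c3 * c1 in let e3 := c1 * c2 * c3 in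
    e1 ^+ 3 - 3 * e1 * e2 + 3 * e3
    - (e1 ^+ 5 - 5 * e1 ^+ 3 * e2 + 5 * e1 * e2 ^+ 2 + 5 * e1 ^+ 2 * e3 - 5 * e2 * e3) by rewrite /=; ring.
  by rewrite /= s1 s2 s3; lra.
clearbody l; subst p.
have g3 : r = l * (1 - c3 ^+ 2).
  have /eqP : c3 * ((c2 + c3) * ((c2 - c3) * (r - l * (1 - c3 ^+ 2)))) = 0.
    by mulby (c2 ^+ 2) h1; mulby (l * c2 ^+ 2) z1; mulby l z3; lra.
  by rewrite !mulf_eq0 (negPf c30) (negPf d23) (negPf a23) /= subr_eq0 => /eqP.
exists l; split => //.
have /eqP : c2 * (q - l * (1 - c2 ^+ 2)) = 0 by mulby l z1; rewrite g3 in h1; lra.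
by rewrite mulf_eq0 (negPf c20) /= subr_eq0 => /eqP.
Qed.

(** The analogue of [heptagon_shear] for two pairs: one equation replaces each
    Vandermonde system. *)
Lemma pentagon_shear a b (S1 S2 d1 d2 : R) : a != 0 -> b != 0 ->
    S1 + S2 != 0 -> a ^+ 2 * S1 + b ^+ 2 * S2 = 0 ->
    a * S1 * d1 + b * S2 * d2 = 0 ->
  exists t, d1 = t * a /\ d2 = t * b.
Proof.
move=> a0 b0 h0 h2 g1.
have S0 : S1 != 0.
  apply/eqP => e; subst S1; have /eqP : b ^+ 2 * S2 = 0 by lra.
  by rewrite mulf_eq0 expf_eq0 (negPf b0) /= => /eqP e; rewrite e addr0 eqxx in h0.
exists (d1 / a); split; first by field.
have /eqP : a * (S1 * (b * d1 - a * d2)) = 0 by mulby b g1; mulby d2 h2; lra.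
rewrite !mulf_eq0 (negPf a0) (negPf S0) /= => /eqP e.
by rewrite mulrAC; apply: (canRL (mulfK a0)); lra.
Qed.

Lemma pentagon_values (A B : R) :
    1 + 2 * (A + B) = 0 -> 1 + 2 * (A ^+ 3 + B ^+ 3) = 0 ->
  A + B = - 2^-1 /\ A * B = - 4^-1.
Proof. move=> h1 h3; have e : B = - 2^-1 - A by lra. split; first lra. rewrite e in h3 *; lra. Qed.

Lemma pentagon_squares (c1 c2 p q : R) : c1 ^+ 2 != 1 ->
    c1 + c2 = - 2^-1 -> c1 * c2 = - 4^-1 -> p * c1 + q * c2 = 0 ->
  exists l, p = l * (1 - c1 ^+ 2) /\ q = l * (1 - c2 ^+ 2).
Proof.
move=> c11 s1 s2 h; have k0 : 1 - c1 ^+ 2 != 0 by rewrite subr_eq0 eq_sym.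
have c20 : c2 != 0 by apply/eqP => e; rewrite e in s2; lra.
set l := p / (1 - c1 ^+ 2).
have lp : p = l * (1 - c1 ^+ 2) by rewrite /l mulfVK.
have z1 : (1 - c1 ^+ 2) * c1 + (1 - c2 ^+ 2) * c2 = 0.
  have -> : (1 - c1 ^+ 2) * c1 + (1 - c2 ^+ 2) * c2 =
   (c1 + c2) - (c1 + c2) ^+ 3 + 3 * (c1 + c2) * (c1 * c2) by ring.
  by rewrite s1 s2; lra.
clearbody l; exists l; split=> //; subst p.
have /eqP : c2 * (q - l * (1 - c2 ^+ 2)) = 0 by mulby l z1; lra.
by rewrite mulf_eq0 (negPf c20) /= subr_eq0 => /eqP.
Qed.

End Scalars.

(** * Coordinates of regular polygons *)

Section Polygons.

Variable R : realType.
Local Notation V := 'cV[R]_2.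
Implicit Types (u v w : V) (s : seq V) (c : R).

Definition vec (x y : R) : V := \col_i (if i == ord0 then x else y).

Definition mirror_pair c : seq V :=
  [:: vec c (Num.sqrt (1 - c ^+ 2)); vec c (- Num.sqrt (1 - c ^+ 2))].

Lemma mirror_pairE c x : x ^+ 2 = 1 - c ^+ 2 ->
  perm_eq [:: vec c x; vec c (- x)] (mirror_pair c).
Proof.
rewrite /mirror_pair => <-; rewrite sqrtr_sqr.
have [x0|x0] := lerP 0 x; first by rewrite ger0_norm.
by rewrite ltr0_norm // opprK (perm_catC [:: _]).
Qed.

Lemma row_mx_mul (u v z : V) : (row_mx u v : 'M[R]_2) *m z = z ord0 ord0 *: u + z ord_max ord0 *: v.
Proof.
have e0 : @lshift 1 1 ord0 = ord0 :> 'I_2 by exact/val_inj.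
have e1 : @rshift 1 1 ord0 = ord_max :> 'I_2 by exact/val_inj.
apply/colP => i; rewrite !mxE big_ord_recl big_ord1.
rewrite (_ : lift ord0 ord0 = ord_max :> 'I_2); last exact/val_inj.
by rewrite -{1}e0 -{1}e1 (row_mxEl u v) (row_mxEr u v) mulrC (mulrC (v _ _)).
Qed.

Lemma exists_coord_change w u m : vdet w u != 0 -> m != 0 ->
  exists2 g : 'M[R]_2, g \in unitmx & forall v, g *m v = vec (vdet v w) (vdet v u / m).
Proof.
move=> wu0 m0.
exists (row_mx (vec (w ord_max ord0) (u ord_max ord0 / m))
  (vec (- w ord0 ord0) (- u ord0 ord0 / m))).
  rewrite unitmxE unitfE -/(vdet _ _) vdetE !mxE /=.
  rewrite (_ : _ - _ = vdet w u / m) ?mulf_neq0 ?invr_eq0 //.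
  by rewrite vdetE; ring.
by move=> v; rewrite row_mx_mul; apply: col2P; rewrite !mxE !vdetE /=; ring.
Qed.

Definition turn (k m : nat) : R := 2 * pi * m%:R / k%:R.

Lemma turn_compl k m : (0 < k)%N -> (m <= k)%N -> turn k (k - m) = - turn k m + pi *+ 2.
Proof.
move=> k0 mk; rewrite /turn natrB //; have kn0 : k%:R != 0 :> R by rewrite pnatr_eq0 -lt0n.
by field.
Qed.

Lemma cos_turn_compl k m : (0 < k)%N -> (m <= k)%N -> cos (turn k (k - m)) = cos (turn k m).
Proof. by move=> k0 mk; rewrite turn_compl // cosD2pi cosN. Qed.

Lemma sin_turn_compl k m : (0 < k)%N -> (m <= k)%N -> sin (turn k (k - m)) = - sin (turn k m).
Proof. by move=> k0 mk; rewrite turn_compl // sinD2pi sinN. Qed.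

Lemma turn0 k : turn k 0 = 0.
Proof. by rewrite /turn mulr0 mul0r. Qed.

Lemma sin_turn_gt0 k m : (0 < m)%N -> (m.*2 < k)%N -> 0 < sin (turn k m).
Proof.
move=> m0 mk; have k0 : 0 < k%:R :> R by rewrite ltr0n (leq_ltn_trans _ mk).
have p0 : 0 < 2 * pi * m%:R :> R by rewrite !mulr_gt0 ?pi_gt0 ?ltr0n.
apply: sin_gt0_pi; apply/andP; split; first by rewrite divr_gt0.
rewrite ltr_pdivrMr // mulrC mulrA mulrC ltr_pM2l ?pi_gt0 //.
by rewrite -natrM ltr_nat muln2.
Qed.

Lemma regular_polygonE k :
  regular_polygon k 1 0 = [seq vec (cos (turn k m)) (sin (turn k m)) | m <- iota 0 k] :> seq V.
Proof.
apply: eq_map => m; apply: col2P; rewrite !mxE /= mul1r ?add0r //.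
Qed.

Lemma cos_turnM k m : cos (turn k m.*2) = 2 * cos (turn k m) ^+ 2 - 1.
Proof.
rewrite (_ : turn k m.*2 = turn k m *+ 2); first by rewrite cos_mulr2n mulr_natl.
by rewrite /turn -mul2n natrM; ring.
Qed.

Lemma cos_turn3 k : cos (turn k 3) = 4 * cos (turn k 1) ^+ 3 - 3 * cos (turn k 1).
Proof.
rewrite (_ : turn k 3 = turn k 1 *+ 2 + turn k 1); last by rewrite /turn; ring.
rewrite cosD cos_mulr2n sin_mulr2n.
have := sin2cos2 (turn k 1); move: (sin _) (cos _) => x c e.
have -> : (c ^+ 2 *+ 2 - 1) * c - (c * x) *+ 2 * x = (c ^+ 2 *+ 2 - 1) * c - 2 * c * x ^+ 2 by ring.
by rewrite e; ring.
Qed.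

Lemma cos_turn_neq1 k : (2 < k)%N -> cos (turn k 1) - 1 != 0.
Proof.
move=> k2; apply/eqP => e; have s0 := @sin_turn_gt0 k 1 isT k2.
have := sin2cos2 (turn k 1); have -> : cos (turn k 1) = 1 by lra.
by nra.
Qed.

(** With x = 2 pi / 7, the relation cos(4 x) = cos(3 x) is a quartic equation for
    cos x; dividing out the root 1 leaves the cubic
    8 T^3 + 4 T^2 - 4 T - 1. *)
Lemma heptagon_cos : let c m := cos (turn 7 m) in
  [/\ c 1 + c 2 + c 3 = - 2^-1, c 1 * c 2 + c 2 * c 3 + c 3 * c 1 = - 2^-1
    & c 1 * c 2 * c 3 = 8^-1].
Proof.
move=> c; have e2 : c 2 = 2 * c 1 ^+ 2 - 1 := cos_turnM 7 1.
have e3 : c 3 = 4 * c 1 ^+ 3 - 3 * c 1 := cos_turn3 7.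
have e4 : c 3 = 2 * c 2 ^+ 2 - 1 by rewrite -cos_turnM (@cos_turn_compl 7 3).
have h : 8 * c 1 ^+ 3 + 4 * c 1 ^+ 2 - 4 * c 1 - 1 = 0.
  apply: (mulfI (@cos_turn_neq1 7 isT)); rewrite -/(c 1) mulr0.
  by rewrite e3 e2 in e4; lra.
clear e4; rewrite e2 e3; clearbody c; move: (c 1) h => x h.
split; first by lra.
  by mulby x h; mulby (x ^+ 2) h; lra.
by mulby x h; mulby (x ^+ 2) h; mulby (x ^+ 3) h; lra.
Qed.

(** Here cos(2 x) = cos(3 x) for x = 2 pi / 5, again with the root 1 divided out. *)
Lemma pentagon_cos : let c m := cos (turn 5 m) in
  c 1 + c 2 = - 2^-1 /\ c 1 * c 2 = - 4^-1.
Proof.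
move=> c; have e2 : c 2 = 2 * c 1 ^+ 2 - 1 := cos_turnM 5 1.
have e3 : c 2 = 4 * c 1 ^+ 3 - 3 * c 1.
  by rewrite -[RHS](cos_turn3 5) /c (@cos_turn_compl 5 2).
have h : 4 * c 1 ^+ 2 + 2 * c 1 - 1 = 0.
  apply: (mulfI (@cos_turn_neq1 5 isT)); rewrite -/(c 1) mulr0.
  by rewrite e2 in e3; lra.
clear e3; rewrite e2; clearbody c; move: (c 1) h => x h.
by split; [lra | mulby x h; lra].
Qed.

(** Reflection in the first axis exchanges the vertices m and k - m, so a polygon
    is known from the cosines alone. *)
Lemma regular_polygon_mirror k h : k = h.*2.+1 ->
  perm_eq (regular_polygon k 1 0 : seq V)
    (vec 1 0 :: flatten [seq mirror_pair (cos (turn k m)) | m <- iota 1 h]).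
Proof.
move=> kh; rewrite regular_polygonE.
have -> : iota 0 k = 0%N :: iota 1 h ++ iota h.+1 h by rewrite kh -addnn /= iotaD add1n.
rewrite map_cons turn0 cos0 sin0 perm_cons map_cat.
have -> : iota h.+1 h = rev [seq (k - m)%N | m <- iota 1 h].
  apply: (@eq_from_nth _ 0%N); rewrite ?size_rev ?size_map ?size_iota // => i ih.
  rewrite nth_rev ?size_map ?size_iota // (nth_map 0%N) ?size_iota ?nth_iota //; lia.
have unrev (X Y : seq V) : perm_eq (X ++ rev Y) (X ++ Y) by rewrite perm_cat2l perm_rev.
rewrite map_rev; apply: (perm_trans (unrev _ _)) => {unrev}.
have : {in iota 1 h, forall m, (0 < m)%N && (m.*2 < k)%N}.
  by move=> m; rewrite mem_iota => /andP[? ?]; lia.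
elim: (iota 1 h) => //= m s IH ms.
have /andP[m0 mk] := ms m (mem_head _ _).
set X := [seq vec _ _ | m <- s]; set Y := map _ (map _ s).
have swap x y : perm_eq (x :: X ++ y :: Y) ([:: x; y] ++ (X ++ Y)).
  by rewrite perm_cons -cat1s perm_catCA.
apply: (perm_trans (swap _ _)).
rewrite cos_turn_compl ?sin_turn_compl; try lia.
apply: (perm_cat (mirror_pairE (sin2cos2 _))).
by apply: IH => j js; apply: ms; rewrite in_cons js orbT.
Qed.

End Polygons.

(** * Balanced vectors on distinct lines form a regular polygon *)

Section NormalForms.

Variable R : realType.
Local Notation V := 'cV[R]_2.
Implicit Types (u v w : V) (s : seq V).

Lemma mirror_pair_image (g : 'M[R]_2) u w m v v' (A : R) : m != 0 ->
    (forall z, g *m z = vec (vdet z w) (vdet z u / m)) ->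
    vdet v w = A -> vdet v' w = A -> vdet v' u = - vdet v u ->
    vdet v u ^+ 2 = m ^+ 2 * (1 - A ^+ 2) ->
  perm_eq [:: g *m v; g *m v'] (mirror_pair A).
Proof.
move=> m0 gE vA v'A v'u e; rewrite !gE vA v'A v'u mulNr; apply: mirror_pairE.
by rewrite expr_div_n e mulrC mulKf ?expf_neq0.
Qed.

Lemma polygon_of_mirror_pairs (g : 'M[R]_2) s k h u t (As : seq R) :
    k = h.*2.+1 -> g \in unitmx -> s = u :: t ->
    g *m u = vec 1 0 ->
    perm_eq [seq g *m v | v <- t] (flatten [seq mirror_pair A | A <- As]) ->
    perm_eq As [seq cos (turn R k m) | m <- iota 1 h] ->
  equiv_regular_polygon k s.
Proof.
move=> kh gU -> gu gt pA; exists 1, 0; split=> //; exists g => //.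
rewrite perm_sym (permPl (regular_polygon_mirror R kh)) perm_sym /= gu perm_cons.
apply: (perm_trans gt); apply: perm_flatten.
have -> : [seq mirror_pair (cos (turn R k m)) | m <- iota 1 h] =
  [seq mirror_pair c | c <- [seq cos (turn R k m) | m <- iota 1 h]] by rewrite -map_comp.
exact: perm_map.
Qed.

Lemma shear_coord u w v v' t : vdet v' u = - vdet v u ->
    vdet v w - vdet v' w = t * vdet v u ->
  vdet v' (w - (t / 2) *: u) = vdet v (w - (t / 2) *: u).
Proof.
move=> e h; rewrite !vdetDr -!scaleNr !vdetZr e; lra.
Qed.

(** The vector u is the axis of a reflection that exchanges each a_i with b_i.
    The last conclusion, for any way of choosing the first pair, is what makes
    the heptagon irreducible. *)
Lemma heptagon_form u a1 b1 a2 b2 a3 b3 :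
    let s := [:: u; a1; b1; a2; b2; a3; b3] in
    nonpar s -> {in s, forall v, symm (dets s v)} ->
    vdet b1 u = - vdet a1 u -> vdet b2 u = - vdet a2 u -> vdet b3 u = - vdet a3 u ->
  equiv_regular_polygon 7 s /\ u + a1 + b1 != 0.
Proof.
move=> s np sy e1 e2 e3.
have u0 : u != 0.
  by apply: contraL np; rewrite /s => /eqP -> /=; rewrite vdet0l eqxx.
have [w uw] := exists_dual u0.
have mom k j z : vdet z u != 0 -> odd k -> (k <= 6)%N -> (j <= k)%N ->
    \sum_(v <- s) vdet v u ^+ j * vdet v z ^+ (k - j) = 0.
  move=> zu ok k6 jk; apply: (moment_eq0 np) => // v vs; exact: symm_psum (sy v vs) ok.
have wu : vdet w u != 0 by rewrite vdetC uw oppr_eq0 oner_eq0.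
have [a10 a20 a30] : [/\ vdet a1 u != 0, vdet a2 u != 0 & vdet a3 u != 0].
  move: np; rewrite /= !(vdetC u) !oppr_eq0.
  by case/andP => /and5P[? _ ? _ /andP[? _]] _.
have [t [t1 t2 t3]] : exists t, [/\ vdet a1 w - vdet b1 w = t * vdet a1 u,
    vdet a2 w - vdet b2 w = t * vdet a2 u & vdet a3 w - vdet b3 w = t * vdet a3 u].
  have := mom 1%N 0%N w wu isT isT isT; have := mom 3 2 w wu isT isT isT.
  have := mom 5 4 w wu isT isT isT; have := mom 3 1%N w wu isT isT isT.
  have := mom 5 3 w wu isT isT isT.
  rewrite /s !big_cons !big_nil !subSS !subn0 vdetvv uw e1 e2 e3.
  move: (vdet a1 u) (vdet a2 u) (vdet a3 u) a10 a20 a30 => a b c a0 b0 c0 h1 h2 h3 h4 h5.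
  apply: (@heptagon_shear _ _ _ _ (vdet a1 w + vdet b1 w)
    (vdet a2 w + vdet b2 w) (vdet a3 w + vdet b3 w)) => //.
  - move: h5; clear; lra.
  - move: h4; clear; lra.
  - move: h3; clear; lra.
  - move: h2; clear; lra.
  - move: h1; clear; lra.
(* The ordinate det(-, z) takes equal values on the two vectors of a pair. *)
pose z := w - (t / 2) *: u.
have uz : vdet u z = 1 by rewrite /z vdetDr -scaleNr vdetZr vdetvv uw; lra.
have zu : vdet z u != 0 by rewrite vdetC uz oppr_eq0 oner_eq0.
have {t1} f1 := shear_coord e1 t1; have {t2} f2 := shear_coord e2 t2; have {t3} f3 := shear_coord e3 t3.
rewrite -/z in f1 f2 f3.
have := mom 1%N 0%N z zu isT isT isT; have := mom 3 0%N z zu isT isT isT.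
have := mom 5 0%N z zu isT isT isT; have := mom 3 2 z zu isT isT isT.
have := mom 5 2 z zu isT isT isT.
rewrite /s !big_cons !big_nil !subSS !subn0 vdetvv uz e1 e2 e3 f1 f2 f3.
set A := vdet a1 z in f1 *; set B := vdet a2 z in f2 *; set C := vdet a3 z in f3 *.
set a := vdet a1 u in a10 e1 *; set b := vdet a2 u in a20 e2 *; set c := vdet a3 u in a30 e3 *.
move=> h1 h2 h3 h4 h5.
have [s1 s2 s3] : [/\ A + B + C = - 2^-1, A * B + B * C + C * A = - 2^-1 & A * B * C = 8^-1].
  by apply: heptagon_values; [move: h5|move: h4|move: h3]; clear; lra.
have cubA : 8 * A ^+ 3 + 4 * A ^+ 2 - 4 * A - 1 = 0.
  mulby (A ^+ 2) s1; mulby A s2; move: s3; clear; lra.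
have [l [l1 l2 l3]] : exists l, [/\ a ^+ 2 = l * (1 - A ^+ 2), b ^+ 2 = l * (1 - B ^+ 2)
    & c ^+ 2 = l * (1 - C ^+ 2)].
  apply: heptagon_squares => //.
  - rewrite sqrf_eq1; apply/norP; split; apply/eqP => e; rewrite e in cubA; lra.
  - by move: h2; clear; lra.
  - by move: h1; clear; lra.
(* Here 7 / 4 is the sum of the three squared sines. *)
have lpos : 0 < l.
  have : 0 < a ^+ 2 + b ^+ 2 + c ^+ 2.
    by rewrite addrAC ltr_wpDl ?addr_ge0 ?sqr_ge0 // lt_def sqr_ge0 expf_neq0.
  have -> : a ^+ 2 + b ^+ 2 + c ^+ 2 = l * (7 / 4).
    rewrite l1 l2 l3.
    have -> : l * (1 - A ^+ 2) + l * (1 - B ^+ 2) + l * (1 - C ^+ 2) =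
      l * (3 - (A + B + C) ^+ 2 + 2 * (A * B + B * C + C * A)) by ring.
    by rewrite s1 s2; congr (_ * _); lra.
  by rewrite pmulr_lgt0 //; lra.
have m0 : Num.sqrt l != 0 by rewrite gt_eqF // sqrtr_gt0.
have ml : Num.sqrt l ^+ 2 = l by rewrite sqr_sqrtr // ltW.
have [g gU gE] := exists_coord_change zu m0.
split.
  apply: (@polygon_of_mirror_pairs g _ _ 3 u _ [:: A; B; C]) => //.
  - by rewrite gE uz vdetvv mul0r.
  - apply: (@perm_cat _ [:: _; _]); first by apply: (mirror_pair_image m0 gE) => //; rewrite ml.
    apply: (@perm_cat _ [:: _; _]); first by apply: (mirror_pair_image m0 gE) => //; rewrite ml.
    by apply: (@perm_cat _ [:: _; _]) => //; apply: (mirror_pair_image m0 gE) => //; rewrite ml.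
  have [k1 k2 k3] := heptagon_cos R.
  by apply: cubic_roots; rewrite ?s1 ?s2 ?s3.
apply/eqP => e; have := congr1 (fun v => vdet v z) e; rewrite !vdetDl uz f1 vdet0l -/A => eA.
have {}eA : A = - 2^-1 by lra.
by rewrite eA in cubA; lra.
Qed.

Lemma pentagon_form u a1 b1 a2 b2 :
    let s := [:: u; a1; b1; a2; b2] in
    nonpar s -> {in s, forall v, symm (dets s v)} ->
    vdet b1 u = - vdet a1 u -> vdet b2 u = - vdet a2 u ->
  equiv_regular_polygon 5 s.
Proof.
move=> s np sy e1 e2.
have u0 : u != 0.
  by apply: contraL np; rewrite /s => /eqP -> /=; rewrite vdet0l eqxx.
have [w uw] := exists_dual u0.
have mom k j z : vdet z u != 0 -> odd k -> (k <= 4)%N -> (j <= k)%N ->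
    \sum_(v <- s) vdet v u ^+ j * vdet v z ^+ (k - j) = 0.
  move=> zu ok k6 jk; apply: (moment_eq0 np) => // v vs; exact: symm_psum (sy v vs) ok.
have wu : vdet w u != 0 by rewrite vdetC uw oppr_eq0 oner_eq0.
have [a10 a20] : vdet a1 u != 0 /\ vdet a2 u != 0.
  by move: np; rewrite /= !(vdetC u) !oppr_eq0; case/andP => /and5P[? _ ? _ _] _.
have [t [t1 t2]] : exists t, vdet a1 w - vdet b1 w = t * vdet a1 u /\
    vdet a2 w - vdet b2 w = t * vdet a2 u.
  have := mom 1%N 0%N w wu isT isT isT; have := mom 3 2 w wu isT isT isT.
  have := mom 3 1%N w wu isT isT isT.
  rewrite /s !big_cons !big_nil !subSS !subn0 vdetvv uw e1 e2.
  move: (vdet a1 u) (vdet a2 u) a10 a20 => a b a0 b0 h1 h2 h3.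
  apply: (@pentagon_shear _ _ _ (vdet a1 w + vdet b1 w) (vdet a2 w + vdet b2 w)) => //.
  - by apply/eqP; move: h3; clear; lra.
  - by move: h2; clear; lra.
  - by move: h1; clear; lra.
pose z := w - (t / 2) *: u.
have uz : vdet u z = 1 by rewrite /z vdetDr -scaleNr vdetZr vdetvv uw; lra.
have zu : vdet z u != 0 by rewrite vdetC uz oppr_eq0 oner_eq0.
have {t1} f1 := shear_coord e1 t1; have {t2} f2 := shear_coord e2 t2.
rewrite -/z in f1 f2.
have := mom 1%N 0%N z zu isT isT isT; have := mom 3 0%N z zu isT isT isT.
have := mom 3 2 z zu isT isT isT.
rewrite /s !big_cons !big_nil !subSS !subn0 vdetvv uz e1 e2 f1 f2.
set A := vdet a1 z in f1 *; set B := vdet a2 z in f2 *.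
set a := vdet a1 u in a10 e1 *; set b := vdet a2 u in a20 e2 *.
move=> h1 h2 h3.
have [s1 s2] : A + B = - 2^-1 /\ A * B = - 4^-1.
  by apply: pentagon_values; [move: h3|move: h2]; clear; lra.
have quadA : 4 * A ^+ 2 + 2 * A - 1 = 0.
  mulby A s1; move: s2; clear; lra.
have [l [l1 l2]] : exists l, a ^+ 2 = l * (1 - A ^+ 2) /\ b ^+ 2 = l * (1 - B ^+ 2).
  apply: pentagon_squares => //.
  - rewrite sqrf_eq1; apply/norP; split; apply/eqP => e; rewrite e in quadA; lra.
  - by move: h1; clear; lra.
(* Here 5 / 4 is the sum of the two squared sines. *)
have lpos : 0 < l.
  have : 0 < a ^+ 2 + b ^+ 2.
    by rewrite ltr_wpDr ?sqr_ge0 // lt_def sqr_ge0 expf_neq0.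
  have -> : a ^+ 2 + b ^+ 2 = l * (5 / 4).
    rewrite l1 l2.
    have -> : l * (1 - A ^+ 2) + l * (1 - B ^+ 2) = l * (2 - (A + B) ^+ 2 + 2 * (A * B)) by ring.
    by rewrite s1 s2; congr (_ * _); lra.
  by rewrite pmulr_lgt0 //; lra.
have m0 : Num.sqrt l != 0 by rewrite gt_eqF // sqrtr_gt0.
have ml : Num.sqrt l ^+ 2 = l by rewrite sqr_sqrtr // ltW.
have [g gU gE] := exists_coord_change zu m0.
apply: (@polygon_of_mirror_pairs g _ _ 2 u _ [:: A; B]) => //.
- by rewrite gE uz vdetvv mul0r.
- apply: (@perm_cat _ [:: _; _]); first by apply: (mirror_pair_image m0 gE) => //; rewrite ml.
  by apply: (@perm_cat _ [:: _; _]) => //; apply: (mirror_pair_image m0 gE) => //; rewrite ml.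
have [k1 k2] := pentagon_cos R.
rewrite /=; have := @pair_roots _ A B _ _ (etrans s1 (esym k1)) (etrans s2 (esym k2)).
by case=> -[-> ->] //; rewrite (perm_catC [:: _]).
Qed.

End NormalForms.

(** * Lines without opposite vectors *)

Section LineSizes.

Variable R : realType.
Local Notation V := 'cV[R]_2.
Implicit Types (u v w x y : V) (s X Y : seq V).

Definition par u v : bool := vdet v u == 0.

Definition linesum s u : V := \sum_(v <- s | par u v) v.

Definition split_or_symm s : Prop :=
  {in s, forall u, linesum s u = 0 \/ symm (dets s u)}.

Definition admissible s : Prop := [/\ 0 \notin s, \sum_(v <- s) v = 0 & split_or_symm s].

Definition opposite_free s : Prop := {in s &, forall u v, u + v != 0}.

Lemma perm_linesum s s' u : perm_eq s s' -> linesum s u = linesum s' u.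
Proof. by move=> h; rewrite /linesum (perm_big _ h). Qed.

Lemma perm_admissible s s' : perm_eq s s' -> admissible s -> admissible s'.
Proof.
move=> h [s0 s1 gs]; split; first by rewrite -(perm_mem h).
  by rewrite -(perm_big _ h).
move=> u; rewrite -(perm_mem h) => /gs; rewrite (perm_linesum _ h).
by rewrite (symm_perm (perm_dets u h)).
Qed.

Lemma perm_opposite_free s s' : perm_eq s s' -> opposite_free s -> opposite_free s'.
Proof. by move=> h ns u v; rewrite -!(perm_mem h); exact: ns. Qed.

Lemma perm_parC s u : perm_eq s ([seq v <- s | par u v] ++ [seq v <- s | predC (par u) v]).
Proof. by rewrite perm_sym; apply/permEl; exact: perm_filterC. Qed.

Lemma linesum_filter s u : linesum s u = \sum_(v <- [seq v <- s | par u v]) v.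
Proof. by rewrite big_filter. Qed.

(** Vectors on the line of u have determinant 0 with u, so balancedness of that
    line may be tested on the whole configuration. *)
Lemma symm_dets_filter s u : symm (dets s u) = symm (dets [seq v <- s | predC (par u) v] u).
Proof. by rewrite symm_filter /dets filter_map. Qed.

(** A balanced line has a complement of even size, because nonzero determinants
    are matched in pairs; in a configuration of odd size, a line with an even
    number of vectors therefore has to split. *)
Lemma even_line_sum s u : admissible s -> odd (size s) -> u \in s ->
  ~~ odd (count (par u) s) -> linesum s u = 0.
Proof.
move=> [s0 _ gs] os us ev; have [//|] := gs u us.
rewrite symm_dets_filter => /symm_even_size.
have -> : 0 \notin dets [seq v <- s | predC (par u) v] u.
  by apply/mapP => -[v]; rewrite mem_filter /par /= => /andP[/eqP v0 _] /esym.
move=> /(_ isT); rewrite size_map size_filter => ev'.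
by move: os; rewrite -(count_predC (par u)) oddD (negbTE ev) (negbTE ev').
Qed.

Lemma par_refl u : par u u. Proof. by rewrite /par vdetvv. Qed.

Lemma par_sym u v : par u v = par v u.
Proof. by rewrite /par vdetC oppr_eq0. Qed.

Lemma par_common x u v : x != 0 -> par x u -> par x v -> par u v.
Proof.
move=> x0 /eqP xu /eqP xv; apply/eqP; apply: (par_trans x0) => //.
by rewrite vdetC xu oppr0.
Qed.

(** A line that carries a single vector cannot split. *)
Lemma single_line_symm s u : admissible s -> u \in s -> count (par u) s = 1%N -> symm (dets s u).
Proof.
move=> [s0 _ gs] us c1; have [|//] := gs u us.
have p := perm_to_rem us; rewrite (perm_linesum _ p) /linesum big_cons par_refl.
move: c1; rewrite (permP p) /= par_refl => -[] /eqP; rewrite eqn0Ngt -has_count => /hasPn nh.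
rewrite big_seq_cond big1; last by move=> v /andP[/nh /negbTE ->].
by rewrite addr0 => u0; move: s0; rewrite -u0 us.
Qed.

Lemma nonpar_count s : {in s, forall u, count (par u) s <= 1}%N -> nonpar s.
Proof.
elim: s => //= u s IH h; apply/andP; split.
  apply/allP => v vs; have := h u (mem_head _ _); rewrite par_refl add1n ltnS leqn0.
  by rewrite eqn0Ngt -has_count => /hasPn/(_ v vs); rewrite par_sym.
by apply: IH => v vs; apply: leq_trans (h v _); rewrite ?leq_addl // in_cons vs orbT.
Qed.

Lemma opposite_on_line u x1 x2 y : vdet u y != 0 -> par u x1 -> par u x2 ->
  vdet x1 y + vdet x2 y = 0 -> x1 + x2 = 0.
Proof.
move=> uy /eqP h1 /eqP h2 h; apply: (vdet_eq0 uy); rewrite vdetDl //.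
by rewrite h1 h2 addr0.
Qed.

(** By [cubes_sum] two of the three determinants are opposite, and on a line a
    determinant against a transversal vector determines the vector. *)
Lemma no_cubic_triple_on_line s u x1 x2 x3 y : opposite_free s -> {subset [:: x1; x2; x3] <= s} ->
    vdet u y != 0 -> all (par u) [:: x1; x2; x3] ->
    vdet x1 y ^+ 3 + vdet x2 y ^+ 3 + vdet x3 y ^+ 3 = (vdet x1 y + vdet x2 y + vdet x3 y) ^+ 3 ->
  False.
Proof.
move=> ns sub uy /and4P[p1 p2 p3 _] /cubes_sum h.
have [m1 m2 m3] : [/\ x1 \in s, x2 \in s & x3 \in s].
  by split; apply: sub; rewrite !inE eqxx ?orbT.
by case: h => /(opposite_on_line uy) h;
  [have := ns x1 x2 m1 m2|have := ns x1 x3 m1 m3|have := ns x2 x3 m2 m3];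
  rewrite h ?eqxx.
Qed.

Lemma seq_size2 (T : Type) (t : seq T) : size t = 2%N -> exists a b, t = [:: a; b].
Proof. by case: t => [|a [|b [|]]] // _; exists a, b. Qed.

Lemma seq_size3 (T : Type) (t : seq T) : size t = 3%N -> exists a b c, t = [:: a; b; c].
Proof. by case: t => [|a [|b [|c [|]]]] // _; exists a, b, c. Qed.

Lemma seq_size4 (T : Type) (t : seq T) : size t = 4%N -> exists a b c d, t = [:: a; b; c; d].
Proof. by case: t => [|a [|b [|c [|d [|]]]]] // _; exists a, b, c, d. Qed.

(** By parity the line splits, so its two vectors are opposite. *)
Lemma no_two_on_line s u : admissible s -> odd (size s) -> opposite_free s -> u \in s ->
  count (par u) s != 2%N.
Proof.
move=> cs os ns us; apply/eqP => c2; have := even_line_sum cs os us; rewrite c2 => /(_ isT).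
rewrite linesum_filter; have := seq_size2 (etrans (size_filter (par u) s) c2).
move=> [x1 [x2 e]].
have sub z : z \in [:: x1; x2] -> z \in s by rewrite -e mem_filter => /andP[].
rewrite e !big_cons big_nil addr0 => /eqP; apply/negP; apply: ns; apply: sub.
  exact: mem_head.
by rewrite !inE eqxx orbT.
Qed.

Lemma split_line s u : admissible s -> opposite_free s -> u \in s ->
  exists X Y, [/\ perm_eq s (X ++ Y), size X = count (par u) s,
    [/\ all (par u) X, all (predC (par u)) Y, linesum s u = \sum_(v <- X) v
      & symm (dets s u) = symm (dets Y u)]
    & admissible (X ++ Y) /\ opposite_free (X ++ Y)].
Proof.
move=> cs ns us; exists [seq v <- s | par u v], [seq v <- s | predC (par u) v].
have p := perm_parC s u; split; rewrite ?size_filter ?filter_all //.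
  by split; rewrite ?filter_all // ?linesum_filter // -symm_dets_filter.
by split; [exact: perm_admissible cs|exact: perm_opposite_free ns].
Qed.

Lemma not_par u x y : x != 0 -> par u x -> ~~ par u y -> par y x = false.
Proof.
move=> x0 ux; apply: contraNF => yx.
by apply: (par_common x0); rewrite par_sym.
Qed.

(** A line of four splits and leaves a single vector of sum zero.  A line of three
    leaves y1, y2, not parallel to each other; at the single line of y1 the
    determinant of y2 is minus the sum of the other three, and P_3(y1) = 0 is
    the cubic relation that yields an opposite pair. *)
Lemma five_nonpar s : size s = 5%N -> admissible s -> opposite_free s ->
  {in s, forall u, count (par u) s < 5}%N -> nonpar s.
Proof.
move=> s5 cs ns lt5; apply: nonpar_count => u us.
have os : odd (size s) by rewrite s5.
have u0 : u != 0 by apply: contraTneq us => ->; case: cs.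
have := no_two_on_line cs os ns us; have := lt5 u us.
have := even_line_sum cs os us.
have [X [Y [p sX [pX pY lX _] [cXY nXY]]]] := split_line cs ns us.
have [s0 sum0 gXY] := cXY; rewrite {}lX -sX.
have : (size X + size Y)%N = 5 by rewrite -size_cat -(perm_size p).
move: sX s0 sum0 => _; rewrite mem_cat negb_or big_cat /= => /andP[X0 Y0] sum0.
have [|] := leqP (size X) 1; first by [].
case eX : (size X) => [|[|[|[|[|//]]]]] // _ szY ev _ n2 //.
  have [y1 [y2 eY]] : exists y1 y2, Y = [:: y1; y2] by apply: seq_size2; lia.
  have [x1 [x2 [x3 {}eX]]] := seq_size3 eX; subst X Y.
  move: X0 Y0; rewrite !inE !negb_or ![0 == _]eq_sym => /and3P[x10 x20 x30] /andP[y10 y20].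
  case/and4P: (pX) => p1 p2 p3 _; case/and3P: pY => q1 q2 _.
  move: sum0; rewrite !big_cons !big_nil !addr0 => sum0.
  have n12 : par y1 y2 = false.
    apply/negP => /eqP y12.
    have X0 : x1 + (x2 + x3) = 0.
      apply: (@vdet_eq0 _ _ u y1); first by rewrite vdetC oppr_eq0.
        by rewrite !vdetDl (eqP p1) (eqP p2) (eqP p3) !addr0.
      have := congr1 (fun v => vdet v y1) sum0; rewrite /= !vdetDl vdet0l y12 vdetvv; lra.
    have := nXY y1 y2; rewrite !inE !eqxx ?orbT /= => /(_ isT isT).
    by move: sum0; rewrite X0 add0r => ->; rewrite eqxx.
  have c1 : count (par y1) [:: x1; x2; x3; y1; y2] = 1%N.
    by rewrite /= par_refl n12 !(@not_par u _ y1).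
  have := single_line_symm cXY _ c1; rewrite !inE eqxx ?orbT => /(_ isT) sy.
  have := @symm_psum _ _ _ 3 sy isT; have := @symm_psum _ _ _ 1 sy isT.
  rewrite /psum !big_cons !big_nil vdetvv => h1 h3.
  exfalso; apply: (no_cubic_triple_on_line nXY _ _ pX (y := y1)).
  - by move=> z; rewrite !inE => /or3P[] ->; rewrite ?orbT.
  - by rewrite vdetC oppr_eq0.
  - have e : vdet y2 y1 = - (vdet x1 y1 + vdet x2 y1 + vdet x3 y1) by lra.
    rewrite e in h3;
    lra.
have [y1 eY] : exists y1, Y = [:: y1].
  by case: Y szY {pY p cXY nXY gXY Y0 sum0} => [|y [|]] //; exists y.
move: sum0; rewrite ev // add0r eY big_cons big_nil addr0 => y0.
by move: Y0; rewrite eY y0 mem_head.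
Qed.

(** A line x = 0 with ordinates k1, k2, k3 and four more vectors (a, y1),
    (-a, z1), (b, y2), (-b, z2).  The moments of degree 3 allow a shear after
    which y1 = z1 = A and y2 = z2 = B with a^2 A + b^2 B = 0.  The sum of the
    fifth powers of the k_i enters the conditions P_5 = 0 at (a, A) and (b, B)
    linearly, and eliminating it leaves (A - B) (A + B)^2 times
    ((A + B)^2 - 3 A B) ((A + B)^2 + A B).  As A B < 0 and A + B <> 0, only the last factor can
    vanish: A and B are the values of a regular pentagon, up to scaling, and
    the k_i satisfy the cubic relation of [cubes_sum]. *)
Lemma pentagon_triple (a b y1 z1 y2 z2 k1 k2 k3 : R) :
    a != 0 -> b != 0 -> y1 + z1 != 0 -> a * y2 - b * y1 != 0 -> a * z2 + b * y1 != 0 ->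
    k1 + k2 + k3 + (y1 + z1) + (y2 + z2) = 0 ->
    k1 ^+ 3 + k2 ^+ 3 + k3 ^+ 3 + (y1 ^+ 3 + z1 ^+ 3) + (y2 ^+ 3 + z2 ^+ 3) = 0 ->
    a * (y1 ^+ 2 - z1 ^+ 2) + b * (y2 ^+ 2 - z2 ^+ 2) = 0 ->
    a ^+ 2 * (y1 + z1) + b ^+ 2 * (y2 + z2) = 0 ->
    (a * k1) ^+ 5 + (a * k2) ^+ 5 + (a * k3) ^+ 5 + (a * (y1 + z1)) ^+ 5
     + (a * y2 - b * y1) ^+ 5 + (a * z2 + b * y1) ^+ 5 = 0 ->
    (b * k1) ^+ 5 + (b * k2) ^+ 5 + (b * k3) ^+ 5 + (b * (y2 + z2)) ^+ 5
     + (b * y1 - a * y2) ^+ 5 + (b * z1 + a * y2) ^+ 5 = 0 ->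
  k1 ^+ 3 + k2 ^+ 3 + k3 ^+ 3 = (k1 + k2 + k3) ^+ 3.
Proof.
move=> a0 b0 S0 n12 n12' h0 h30 h31 h32 g1 g2.
(* Otherwise the four vectors would form two opposite pairs. *)
have S12 : (y1 + z1) + (y2 + z2) != 0.
  apply/eqP => e; have eS : y2 + z2 = - (y1 + z1) by lra.
  have /eqP : (a - b) * ((a + b) * (y1 + z1)) = 0 by mulby (b ^+ 2) eS; lra.
  rewrite !mulf_eq0 (negPf S0) orbF subr_eq0 addr_eq0 => /orP[] /eqP ab; subst a.
    have /eqP : b * ((y1 + z1) * (y1 + z2)) = 0.
      by mulby (b * (y2 - z2)) eS; mulby (b * (y1 + z1)) eS; lra.
    rewrite !mulf_eq0 (negPf S0) (negPf b0) /= => /eqP e1.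
    by move/eqP: n12'; apply; mulby b e1; lra.
  have /eqP : b * ((y1 + z1) * (y1 + y2)) = 0.
    by mulby (b * (y2 - z2)) eS; mulby (b * (y1 + z1)) eS; lra.
  rewrite !mulf_eq0 (negPf S0) (negPf b0) /= => /eqP e1.
  by move/eqP: n12; apply; mulby b e1; lra.
have [t [t1 t2]] : exists t, y1 - z1 = t * a /\ y2 - z2 = t * b.
  by apply: (@pentagon_shear _ _ _ (y1 + z1) (y2 + z2)) => //; lra.
pose A := (y1 + z1) / 2; pose B := (y2 + z2) / 2; pose r := t / 2.
have ey1 : y1 = A + r * a by rewrite /A /r; lra.
have ez1 : z1 = A - r * a by rewrite /A /r; lra.
have ey2 : y2 = B + r * b by rewrite /B /r; lra.
have ez2 : z2 = B - r * b by rewrite /B /r; lra.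
clearbody A B r; subst y1 z1 y2 z2; clear t1 t2.
have m : b ^+ 2 * B = - (a ^+ 2 * A) by lra.
have A0 : A != 0 by apply: contra_neq S0 => ->; lra.
have s0 : A + B != 0 by apply/eqP => e; move/eqP: S12; apply; lra.
have K1 : B * (k1 ^+ 5 + k2 ^+ 5 + k3 ^+ 5 + 32 * A ^+ 5 + 2 * B ^+ 5)
  - 20 * A ^+ 3 * B ^+ 3 + 10 * A ^+ 6 = 0.
  apply: (mulfI (expf_neq0 5 a0)); rewrite mulr0.
  mulby B g1.
  mulby (20 * a ^+ 3 * A ^+ 2 * B ^+ 3) m.
  have m2 : (b ^+ 2 * B) ^+ 2 = (a ^+ 2 * A) ^+ 2 by rewrite m; ring.
  mulby (10 * a * A ^+ 4) m2.
  clear; lra.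
have K2 : A * (k1 ^+ 5 + k2 ^+ 5 + k3 ^+ 5 + 32 * B ^+ 5 + 2 * A ^+ 5)
  - 20 * A ^+ 3 * B ^+ 3 + 10 * B ^+ 6 = 0.
  apply: (mulfI (expf_neq0 5 b0)); rewrite mulr0.
  mulby A g2.
  mulby (20 * b ^+ 3 * B ^+ 2 * A ^+ 3) m.
  have m2 : (b ^+ 2 * B) ^+ 2 = (a ^+ 2 * A) ^+ 2 by rewrite m; ring.
  mulby (10 * b * B ^+ 4) m2.
  clear; lra.
have a2 : 0 < a ^+ 2 by rewrite lt_def sqr_ge0 expf_neq0.
have b2 : 0 < b ^+ 2 by rewrite lt_def sqr_ge0 expf_neq0.
have AB : A * B < 0.
  have : b ^+ 2 * (A * B) < 0.
    have -> : b ^+ 2 * (A * B) = - (a ^+ 2 * A ^+ 2) by mulby A m; lra.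
    by rewrite oppr_lt0 mulr_gt0 // lt_def sqr_ge0 expf_neq0.
  by rewrite pmulr_rlt0.
have ABn : A - B != 0.
  apply/eqP => e; have e' : A = B by lra.
  by move: AB; rewrite e'; have := sqr_ge0 B; rewrite expr2; lra.
have /eqP : (A - B) * ((A + B) ^+ 2 * (((A + B) ^+ 2 - 3 * (A * B)) * ((A + B) ^+ 2 + A * B))) = 0.
  mulby A K1; mulby B K2; clear; lra.
have sq : (A + B) ^+ 2 - 3 * (A * B) != 0 by apply/eqP => e; have := sqr_ge0 (A + B); lra.
rewrite mulf_eq0 (negPf ABn) mulf_eq0 expf_eq0 (negPf s0) mulf_eq0 (negPf sq) /= => /eqP e.
have h30' : k1 ^+ 3 + k2 ^+ 3 + k3 ^+ 3 = - 2 * (A ^+ 3 + B ^+ 3).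
  by mulby (6 * r ^+ 2) h32; move: h30; clear; lra.
have -> : k1 + k2 + k3 = - 2 * (A + B) by lra.
by rewrite h30'; mulby (6 * (A + B)) e; clear; lra.
Qed.

End LineSizes.

(** * Seven vectors without opposite pair *)

Section Seven.

Variable R : realType.
Local Notation V := 'cV[R]_2.
Implicit Types (u v w x y : V) (s X Y : seq V).

Definition two_lines s : Prop := exists x y X Y,
  [/\ perm_eq s ((x :: X) ++ (y :: Y)), all (par x) X, all (par y) Y, ~~ par x y
    & \sum_(v <- x :: X) v = 0 /\ \sum_(v <- y :: Y) v = 0].

Lemma four_opposite (a b c d : R) : a + b + c + d = 0 ->
    a ^+ 3 + b ^+ 3 + c ^+ 3 + d ^+ 3 = 0 ->
  [\/ b = - a, c = - a | d = - a].
Proof.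
move=> h1 h3; have e : d = - (a + b + c) by lra.
have /cubes_sum[h|h|h] : a ^+ 3 + b ^+ 3 + c ^+ 3 = (a + b + c) ^+ 3 by rewrite e in h3; lra.
- by constructor 1; lra.
- by constructor 2; lra.
- by constructor 3; lra.
Qed.

Lemma no_opposite_on_line s u y x1 x2 : opposite_free s -> x1 \in s -> x2 \in s ->
  vdet u y != 0 -> par u x1 -> par u x2 -> vdet x2 y != - vdet x1 y.
Proof.
move=> ns m1 m2 uy p1 p2; apply: contraNneq (ns _ _ m1 m2) => e.
by apply/eqP; apply: (opposite_on_line uy p1 p2); rewrite e addrN.
Qed.

(** A line of four splits by parity, so the other three vectors y1, y2, y3 sum to
    zero too.  If they are not collinear, the line of y1 is single, the
    determinants of y2 and y3 cancel there, and P_1 = P_3 = 0 produce an opposite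
    pair among the four. *)
Lemma line_of_four s u : size s = 7%N -> admissible s -> opposite_free s -> u \in s ->
  count (par u) s = 4%N -> two_lines s.
Proof.
move=> s7 cs ns us c4.
have os : odd (size s) by rewrite s7.
have u0 : u != 0 by apply: contraTneq us => ->; case: cs.
have ls : linesum s u = 0 by apply: even_line_sum; rewrite ?c4.
have [X [Y [p sX [pX pY lX _] [cXY nXY]]]] := split_line cs ns us.
have sY : size Y = 3%N by move: s7; rewrite (perm_size p) size_cat sX c4 => -[].
rewrite {}c4 in sX; rewrite {}ls in lX.
have [x1 [x2 [x3 [x4 eX]]]] := seq_size4 sX; have [y1 [y2 [y3 eY]]] := seq_size3 sY.
subst X Y; have [s0 sum0 gXY] := cXY.
move: s0; rewrite !inE !negb_or ![0 == _]eq_sym => /and5P[x10 x20 x30 x40 /and3P[y10 y20 y30]].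
case/and5P: (pX) => p1 p2 p3 p4 _; case/and4P: (pY) => q1 q2 q3 _.
move: sum0; rewrite big_cat /= -lX add0r => sumY.
have [y12|y12] := boolP (par y1 y2).
  exists x1, y1, [:: x2; x3; x4], [:: y2; y3]; split => //.
  - by rewrite /= (par_common u0 p1 p2) (par_common u0 p1 p3) (par_common u0 p1 p4).
  - have := congr1 (fun v => vdet v y1) sumY; rewrite /= y12 andbT.
    by rewrite vdet_suml vdet0l !big_cons big_nil vdetvv (eqP y12) !add0r addr0 => /eqP.
  - apply: contra q1 => xy; by apply: (par_common x10) xy; rewrite par_sym.
have y13 : vdet y3 y1 = - vdet y2 y1.
  by have := congr1 (fun v => vdet v y1) sumY; rewrite /= vdet_suml vdet0l !big_cons big_nil vdetvv; lra.
have c1 : count (par y1) ([:: x1; x2; x3; x4] ++ [:: y1; y2; y3]) = 1%N.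
  rewrite /= par_refl (not_par x10 p1 q1) (not_par x20 p2 q1)
    (not_par x30 p3 q1) (not_par x40 p4 q1) (negPf y12).
  by rewrite /par y13 oppr_eq0 -[_ == 0]/(par y1 y2) (negPf y12).
exfalso.
have y1in : y1 \in [:: x1; x2; x3; x4] ++ [:: y1; y2; y3] by rewrite !inE eqxx ?orbT.
have sy := single_line_symm cXY y1in c1.
have := @symm_psum _ _ _ 3 sy isT.
move: (esym lX) => /(congr1 (fun v => vdet v y1)).
rewrite /psum /= vdet_suml vdet0l !big_cons !big_nil vdetvv y13 => h1 h3.
have uy : vdet u y1 != 0 by rewrite vdetC oppr_eq0.
case: (@four_opposite (vdet x1 y1) (vdet x2 y1) (vdet x3 y1) (vdet x4 y1)); [lra|lra| | |] => e.
- by move/eqP: e; apply/negP; apply: (no_opposite_on_line nXY _ _ uy p1 p2); rewrite !inE eqxx ?orbT.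
- by move/eqP: e; apply/negP; apply: (no_opposite_on_line nXY _ _ uy p1 p3); rewrite !inE eqxx ?orbT.
- by move/eqP: e; apply/negP; apply: (no_opposite_on_line nXY _ _ uy p1 p4); rewrite !inE eqxx ?orbT.
Qed.

(** In the coordinates given by the line of the triple and a dual vector, the
    hypotheses become those of [pentagon_triple]. *)
Lemma no_triple_with_four_singles s u x1 x2 x3 v1 w1 v2 w2 :
    s = [:: x1; x2; x3; v1; w1; v2; w2] -> u != 0 -> 
    par u x1 -> par u x2 -> par u x3 -> nonpar [:: u; v1; w1; v2; w2] ->
    \sum_(v <- s) v = 0 -> {in [:: v1; w1; v2; w2], forall v, symm (dets s v)} ->
    psum s 3 u = 0 -> vdet w1 u = - vdet v1 u -> vdet w2 u = - vdet v2 u -> opposite_free s ->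
  False.
Proof.
move=> es u0 /eqP p1 /eqP p2 /eqP p3 np sum0 sy p3u e1 e2 ns.
have [w uw] := exists_dual u0.
have wu : vdet w u != 0 by rewrite vdetC uw oppr_eq0 oner_eq0.
have P3 : {in [:: u; v1; w1; v2; w2], forall v, psum s 3 v = 0}.
  move=> v; rewrite in_cons => /orP[/eqP ->|/sy/symm_psum->] //.
have mom j : (j <= 3)%N -> \sum_(v <- s) vdet v u ^+ j * vdet v w ^+ (3 - j) = 0.
  exact: (moment_eq0 np _ P3 wu).
have det v v' : vdet v v' = vdet v u * vdet v' w - vdet v' u * vdet v w.
  by have := plucker v v' u w; rewrite uw (vdetC u v'); lra.
have := mom 0%N isT; have := mom 1%N isT; have := mom 2 isT.
have := congr1 (fun v => vdet v w) sum0.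
have : psum s 5 v1 = 0 by apply: symm_psum => //; apply: sy; rewrite mem_head.
have : psum s 5 v2 = 0 by apply: symm_psum => //; apply: sy; rewrite !inE eqxx ?orbT.
rewrite /= vdet_suml vdet0l /psum es !big_cons !big_nil !subSS !subn0.
rewrite !(det _ v1) !(det _ v2) p1 p2 p3 e1 e2 => h52 h51 h1 h2 h31 h30.
move: np; rewrite /= !(vdetC u) !oppr_eq0 => /and5P[/and5P[a0 _ b0 _ _] /and4P[n1 n2 n3 _] _ _ _].
apply: (@no_cubic_triple_on_line _ s u x1 x2 x3 w) => //.
- by rewrite es => z; rewrite !inE => /or3P[] ->; rewrite ?orbT.
- by rewrite uw oner_eq0.
- by rewrite /= /par p1 p2 p3 eqxx.
apply: (@pentagon_triple _ (vdet v1 u) (vdet v2 u)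
  (vdet v1 w) (vdet w1 w) (vdet v2 w) (vdet w2 w)) => //.
- move: n1; rewrite det e1; apply: contra_neq => h. 
  by rewrite -[RHS](mulr0 (vdet v1 u)) -h; clear; lra.
- by move: n2; rewrite det.
- by move: n3; rewrite det e2; congr (_ != 0); clear; lra.
- by move: h1; clear; lra.
- by move: h30; clear; lra.
- by move: h31; clear; lra.
- by move: h2; clear; lra.
- by move: h51; clear; lra.
- by move: h52; clear; lra.
Qed.

Lemma nonparP s : reflect (uniq s /\ {in s &, forall u v, u != v -> ~~ par u v}) (nonpar s).
Proof.
apply: (iffP idP); elim: s => [|u s IH] //=.
  move=> /andP[/allP us /IH[s1 s2]]; split.
    by rewrite s1 andbT; apply/negP => /us; rewrite vdetvv eqxx.
  move=> v w; rewrite !in_cons => /orP[/eqP ->|vs] /orP[/eqP ->|ws]; rewrite ?eqxx //.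
  - by rewrite par_sym; move=> _; exact: us.
  - by move=> _; exact: us.
  - exact: s2.
move=> [/andP[us uqs] h]; apply/andP; split.
  apply/allP => v vs; rewrite -/(par v u); apply: h; rewrite ?mem_head ?in_cons ?vs ?orbT //.
  by apply: contraNneq us => <-.
by apply: IH; split=> // v w vs ws; apply: h; rewrite in_cons ?vs ?ws orbT.
Qed.

Lemma perm_nonpar s s' : perm_eq s s' -> nonpar s -> nonpar s'.
Proof.
move=> p /nonparP[us h]; apply/nonparP; split; first by rewrite -(perm_uniq p).
by move=> u v; rewrite -!(perm_mem p); exact: h.
Qed.

(** If another line also carries three vectors, the seventh one w is alone; the
    first line does not split, since otherwise w would lie on the second line,
    and the determinants at the first line give the cubic relation for the
    second.  Otherwise the four other vectors are on single lines; P_3 vanishes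
    there, hence everywhere, and at the line of the triple this pairs the four
    vectors. *)
Lemma no_line_of_three s u : size s = 7%N -> admissible s -> opposite_free s ->
    {in s, forall y, count (par y) s < 5}%N -> {in s, forall y, count (par y) s != 4%N} ->
  u \in s -> count (par u) s != 3%N.
Proof.
move=> s7 cs ns lt5 n4 us; apply/eqP => c3.
have os : odd (size s) by rewrite s7.
have u0 : u != 0 by apply: contraTneq us => ->; case: cs.
have [X [Y [p sX [pX pY lX dY] _]]] := split_line cs ns us.
have [s0 sum0 gs] := cs.
have X0 : 0 \notin X by apply: contra s0; rewrite (perm_mem p) mem_cat => ->.
have Xs : {subset X <= s} by move=> x xX; rewrite (perm_mem p) mem_cat xX.
have Ys : {subset Y <= s} by move=> x xY; rewrite (perm_mem p) mem_cat xY orbT.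
have sY : size Y = 4%N by move: s7; rewrite (perm_size p) size_cat sX c3 => -[].
rewrite c3 in sX.
have sumXu k : odd k -> \sum_(x <- X) vdet x u ^+ k = 0.
  move=> ok; rewrite big_seq; apply: big1 => x /(allP pX)/eqP ->.
  by case: k ok => // k _; rewrite expr0n.
have parX y : y \in Y -> count (par y) X = 0%N.
  move=> /(allP pY) uy; apply/eqP; rewrite eqn0Ngt -has_count; apply/hasPn => x xX.
  by rewrite (@not_par _ u x y) ?(allP pX x xX) //; apply: contraNneq X0 => <-.
have [/hasP[y yY /eqP cy]|/hasPn nY] := boolP (has (fun y => count (par y) s == 3%N) Y).
  have uy : vdet u y != 0 by rewrite vdetC oppr_eq0; exact: (allP pY).
  have pq := perm_parC Y y.
  have s3 : size [seq v <- Y | par y v] = 3%N.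
    by rewrite size_filter -cy (permP p) count_cat parX.
  have s1 : size [seq v <- Y | predC (par y) v] = 1%N.
    by apply/eqP; rewrite -(eqn_add2l 3) -{1}s3 -size_cat -(perm_size pq) sY.
  have pY' : all (par y) [seq v <- Y | par y v] by rewrite filter_all.
  have nZ : all (predC (par y)) [seq v <- Y | predC (par y) v] by rewrite filter_all.
  have sub : {subset [seq v <- Y | par y v] <= s} by move=> v; rewrite mem_filter => /andP[_ /Ys].
  move: pq s3 s1 pY' nZ sub.
  move: [seq v <- Y | par y v] [seq v <- Y | predC (par y) v] => Y' Z pq.
  move=> /seq_size3[y1 [y2 [y3 eY']]] sZ; subst Y'.
  case: Z pq sZ => [|z [|]] // pq _ pY' /= /andP[yz _] sub.
  have ls : linesum s u != 0.
    rewrite lX; apply: contra_neq yz => e.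
    have : \sum_(v <- [:: y1; y2; y3] ++ [:: z]) v = 0.
      by rewrite -(perm_big _ pq) -[RHS]sum0 (perm_big _ p) big_cat /= e add0r.
    move=> /(congr1 (fun v => vdet v y)); rewrite /= vdet_suml vdet0l !big_cons big_nil.
    by case/and4P: pY' => /eqP -> /eqP -> /eqP -> _; rewrite !add0r addr0.
  have [/eqP|sy] := gs u us; first by rewrite (negPf ls).
  have h k : odd k -> vdet y1 u ^+ k + (vdet y2 u ^+ k + (vdet y3 u ^+ k + vdet z u ^+ k)) = 0.
    move=> ok; have := symm_psum sy ok; rewrite /psum (perm_big _ p) big_cat /= sumXu // add0r.
    by rewrite (perm_big _ pq) /= !big_cons big_nil addr0.
  have h1 := h 1%N isT; have h3 := h 3 isT.
  apply: (@no_cubic_triple_on_line _ s y y1 y2 y3 u) => //; first by rewrite vdetC oppr_eq0.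
  have e : vdet z u = - (vdet y1 u + vdet y2 u + vdet y3 u) by lra.
  by rewrite e in h3; lra.
have cY y : y \in Y -> count (par y) s = 1%N.
  move=> yY; have ys := Ys y yY.
  have := no_two_on_line cs os ns ys; have := n4 y ys; have := lt5 y ys; have := nY y yY.
  have : (0 < count (par y) s)%N by rewrite -has_count; apply/hasP; exists y; rewrite ?par_refl.
  by case: (count _ _) => [|[|[|[|[|]]]]].
have npY : nonpar Y.
  apply: nonpar_count => y yY; apply: leq_trans (eq_leq (cY y yY)).
  by rewrite (permP p) count_cat leq_addl.
have syY : {in Y, forall y, symm (dets s y)}.
  by move=> y yY; apply: single_line_symm => //; [exact: Ys|exact: cY].
have npuY : nonpar (u :: Y).
  by rewrite /= -/(nonpar Y) npY andbT; apply/allP => y /(allP pY); rewrite /= /par vdetC oppr_eq0.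
have p3u : psum s 3 u = 0.
  have := sY; case: Y npY npuY syY {sY p pY dY Ys parX nY cY} => // y1 Y npY npuY syY [sY].
  have uy1 : vdet u y1 != 0 by case/andP: npuY => /andP[].
  have P3 : {in y1 :: Y, forall v, psum s 3 v = 0} by move=> v vY; exact: symm_psum (syY v vY) _.
  have := @moment_eq0 _ s 3 y1 Y npY _ P3 u 0%N uy1 isT; rewrite sY => /(_ isT) <-.
  by rewrite /psum; apply: eq_bigr => v _; rewrite mul1r subn0.
have p1u : psum s 1 u = 0 by rewrite psum1 sum0 vdet0l.
have [y1 [y2 [y3 [y4 eY]]]] := seq_size4 sY.
have h k : odd k ->
    psum s k u = vdet y1 u ^+ k + (vdet y2 u ^+ k + (vdet y3 u ^+ k + vdet y4 u ^+ k)).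
  by move=> ok; rewrite /psum (perm_big _ p) big_cat /= sumXu // add0r eY !big_cons big_nil addr0.
have h1 := h 1%N isT; have h3 := h 3 isT; rewrite p1u in h1; rewrite p3u in h3.
have [v1 [w1 [v2 [w2 [pv e1 e2]]]]] : exists v1 w1 v2 w2,
    [/\ perm_eq Y [:: v1; w1; v2; w2], vdet w1 u = - vdet v1 u & vdet w2 u = - vdet v2 u].
  have [|| e|e|e] := @four_opposite (vdet y1 u) (vdet y2 u) (vdet y3 u) (vdet y4 u); [lra|lra|..].
  - by exists y1, y2, y3, y4; split; rewrite ?eY //; lra.
  - exists y1, y3, y2, y4; split => //; last lra.
    by rewrite eY perm_cons (perm_catCA [:: _] [:: _]).
  - exists y1, y4, y2, y3; split => //; last lra.
    by rewrite eY perm_cons (perm_catC [:: _; _]).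
have [x1 [x2 [x3 eX]]] := seq_size3 sX.
have ps : perm_eq s (X ++ [:: v1; w1; v2; w2]) by rewrite (permPl p) perm_cat2l.
have pu : perm_eq (u :: Y) [:: u; v1; w1; v2; w2] by rewrite perm_cons.
move: (pX); rewrite eX in ps * => /and4P[q1 q2 q3 _].
apply: (@no_triple_with_four_singles _ u x1 x2 x3 v1 w1 v2 w2 (erefl _)) => //.
- exact: perm_nonpar npuY.
- by rewrite -[RHS]sum0 (perm_big _ ps).
- move=> v; rewrite -(perm_mem pv) => /syY.
  by rewrite (symm_perm (perm_dets v ps)).
- by rewrite -[RHS]p3u (perm_psum _ _ ps).
- exact: perm_opposite_free ns.
Qed.

Lemma seven_nonpar s : size s = 7%N -> admissible s -> opposite_free s ->
  {in s, forall u, count (par u) s < 5}%N -> nonpar s \/ two_lines s.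
Proof.
move=> s7 cs ns lt5.
have [/hasP[u us /eqP c4]|/hasPn n4] := boolP (has (fun u => count (par u) s == 4%N) s).
  by right; apply: (line_of_four s7 cs ns us).
left; apply: nonpar_count => u us.
have os : odd (size s) by rewrite s7.
have := no_line_of_three s7 cs ns lt5 n4 us; have := no_two_on_line cs os ns us.
by have := lt5 u us; have := n4 u us; case: (count _ _) => [|[|[|[|[|]]]]].
Qed.

End Seven.

(** * Classification by opposite pairs *)

Section Classification.

Variable R : realType.
Local Notation V := 'cV[R]_2.
Implicit Types (u v w x y p q : V) (s t X Y : seq V).

Lemma perm_equiv_regular_polygon k s t : perm_eq s t ->
  equiv_regular_polygon k s -> equiv_regular_polygon k t.
Proof.
move=> st [r [a [r0 [g gU gs]]]]; exists r, a; split=> //; exists g => //.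
by apply: perm_trans gs; apply: perm_map; rewrite perm_sym.
Qed.

Lemma nonpar_symm s : admissible s -> nonpar s -> {in s, forall u, symm (dets s u)}.
Proof.
move=> cs /nonparP[uqs h] u us; apply: single_line_symm => //.
rewrite (permP (perm_to_rem us)) /= par_refl; apply/eqP; rewrite eqSS eqn0Ngt -has_count.
apply/hasPn => v vs; apply: h => //; first exact: mem_rem vs.
by apply: contraTneq vs => <-; rewrite mem_rem_uniqF.
Qed.

Lemma opposite_extract s : 0 \notin s -> ~ opposite_free s ->
  exists p t, perm_eq s (p :: - p :: t).
Proof.
move=> s0 ns; have [p [q [ps qs pq]]] : exists p q, [/\ p \in s, q \in s & p + q = 0].
  apply: contrapT => h; apply: ns => p q ps qs; apply/eqP => e; apply: h.
  by exists p, q.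
have eq : q = - p by apply/eqP; rewrite -addr_eq0 addrC pq.
subst q; have qr : - p \in rem p s.
  have := perm_mem (perm_to_rem ps) (- p); rewrite qs in_cons => /esym/orP[/eqP e|//].
  have : p + p = 0 by rewrite -{2}e addrN.
  rewrite -[p]scale1r -scalerDl => /eqP; rewrite scaler_eq0 => /orP[/eqP|/eqP p0]; first by lra.
  by rewrite p0 in ps; rewrite ps in s0.
exists p, (rem (- p) (rem p s)).
by rewrite (permPl (perm_to_rem ps)) perm_cons perm_to_rem.
Qed.

Lemma linesum_cons2 p s u : linesum (p :: - p :: s) u = linesum s u.
Proof.
rewrite /linesum !big_cons /par !vdetNl !oppr_eq0.
by case: (vdet p u == 0); rewrite ?addNKr.
Qed.

Lemma symm_dets_cons2 p s u : symm (dets (p :: - p :: s) u) = symm (dets s u).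
Proof. by rewrite /= vdetNl symm_cons2. Qed.

Lemma admissible_cons2 p s : admissible (p :: - p :: s) -> admissible s.
Proof.
move=> [s0 sum0 gs]; split.
- by apply: contra s0 => s0; rewrite !in_cons s0 !orbT.
- by rewrite -[RHS]sum0 !big_cons addrA addrN add0r.
- move=> u us; have := gs u; rewrite !in_cons us !orbT linesum_cons2 symm_dets_cons2.
  exact.
Qed.

Lemma symm_dets_self u s : symm (dets (u :: s) u) = symm (dets s u).
Proof. by rewrite /= vdetvv symm_cons0. Qed.

Lemma peel_pair u s n : size s = n.+2 -> {in s, forall v, vdet v u != 0} -> symm (dets s u) ->
  exists a b t, [/\ perm_eq s (a :: b :: t), vdet b u = - vdet a u, size t = n,
    {in t, forall v, vdet v u != 0} & symm (dets t u)].
Proof.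
case: s => // a s [ss] nz sy.
have [b [t [p e st]]] := symm_split sy (nz a (mem_head _ _)).
exists a, b, t; split => //; first by rewrite perm_cons.
  by have := perm_size p; rewrite ss => -[].
by move=> v vt; apply: nz; rewrite in_cons (perm_mem p) in_cons vt !orbT.
Qed.

Lemma nonpar_cons_neq0 u s : nonpar (u :: s) -> {in s, forall v, vdet v u != 0}.
Proof. by move=> /andP[/allP us _] v /us; rewrite vdetC oppr_eq0. Qed.

Lemma pentagon_of_nonpar s : size s = 5%N -> nonpar s -> {in s, forall u, symm (dets s u)} ->
  equiv_regular_polygon 5 s.
Proof.
case: s => // u s [s4] np sy.
have := sy u (mem_head _ _); rewrite symm_dets_self => syu.
have [a1 [b1 [t [p1 e1 st nz {}syu]]]] := peel_pair s4 (nonpar_cons_neq0 np) syu.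
have [a2 [b2 [r [p2 e2 sr _ _]]]] := peel_pair st nz syu.
move: p2; rewrite (size0nil sr) => p2.
have p : perm_eq (u :: s) [:: u; a1; b1; a2; b2].
  by rewrite perm_cons (permPl p1) !perm_cons.
apply: (@perm_equiv_regular_polygon _ [:: u; a1; b1; a2; b2]); first by rewrite perm_sym.
apply: pentagon_form => //; first exact: perm_nonpar p np.
by move=> v; rewrite -(perm_mem p) -(symm_perm (perm_dets v p)); exact: sy.
Qed.

(** Stated with an arbitrary first pair (a, b), since irreducibility needs a pair
    chosen in advance. *)
Lemma heptagon_at s u a b t : perm_eq s [:: u, a, b & t] -> size s = 7%N -> nonpar s ->
    {in s, forall u, symm (dets s u)} -> vdet b u = - vdet a u ->
  equiv_regular_polygon 7 s /\ u + a + b != 0.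
Proof.
move=> p s7 np sy e.
have np' := perm_nonpar p np.
have := sy u; rewrite (perm_mem p) mem_head => /(_ isT).
rewrite (symm_perm (perm_dets u p)) symm_dets_self /= e symm_cons2 => syt.
have nz : {in t, forall v, vdet v u != 0}.
  by move=> v vt; apply: (nonpar_cons_neq0 np'); rewrite !in_cons vt !orbT.
have st : size t = 4%N by move: s7; rewrite (perm_size p) => -[].
have [a1 [b1 [t' [p1 e1 st' nz' sy']]]] := peel_pair st nz syt.
have [a2 [b2 [r [p2 e2 sr _ _]]]] := peel_pair st' nz' sy'.
move: p2; rewrite (size0nil sr) => p2.
have p' : perm_eq s [:: u; a; b; a1; b1; a2; b2].
  by rewrite (permPl p) !perm_cons (permPl p1) !perm_cons.
have [||h1 h2] := @heptagon_form R u a b a1 b1 a2 b2 _ _ e e1 e2.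
- exact: perm_nonpar p' np.
- by move=> v; rewrite -(perm_mem p') -(symm_perm (perm_dets v p')); exact: sy.
by split=> //; apply: perm_equiv_regular_polygon h1; rewrite perm_sym.
Qed.

Lemma heptagon_of_nonpar s : size s = 7%N -> nonpar s -> {in s, forall u, symm (dets s u)} ->
  equiv_regular_polygon 7 s.
Proof.
case: s => // u s [s6] np sy.
have := sy u (mem_head _ _); rewrite symm_dets_self => syu.
have [a [b [t [p e _ _ _]]]] := peel_pair s6 (nonpar_cons_neq0 np) syu.
have p' : perm_eq (u :: s) [:: u, a, b & t] by rewrite perm_cons.
by have [] := heptagon_at p' _ np sy e; rewrite /= ?s6.
Qed.

Definition splits s : Prop := exists s1 s2,
  [/\ perm_eq s (s1 ++ s2), s1 != [::], s2 != [::],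
     \sum_(v <- s1) v = 0 & \sum_(v <- s2) v = 0].

(** One of the two parts has at most three vectors, and on distinct lines this
    leaves u + a + b = 0.  Then det(b, u) = - det(a, u), so that a and b form a
    pair for the reflection fixing u. *)
Lemma heptagon_not_splits s : size s = 7%N -> nonpar s -> {in s, forall u, symm (dets s u)} ->
  ~ splits s.
Proof.
move=> s7 np sy [s1 [s2 [p]]].
wlog le3 : s1 s2 p / (size s1 <= 3)%N.
  move=> H n1 n2 z1 z2; have := s7; rewrite (perm_size p) size_cat => e.
  case: (leqP (size s1) 3) => le; first exact: (H s1 s2).
  apply: (H s2 s1) => //; first by rewrite (permPl p) perm_catC.
  by rewrite leqNgt; apply/negP => le'; have := leq_add le le'; rewrite e.
have npp := perm_nonpar p np.
case: s1 p le3 npp => [|u [|a [|b [|//]]]] // p _ npp _ _ sum0 _.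
- have u0 : u = 0 by move: sum0; rewrite big_cons big_nil addr0.
  have := npp; case: s2 p {npp} => [|v s2] p; first by move: s7; rewrite (perm_size p).
  by rewrite /= u0 vdet0l eqxx.
- move: npp => /andP[/allP/(_ a (mem_head _ _))].
  have -> : a = - u by apply/eqP; rewrite -addr_eq0 addrC -sum0 !big_cons big_nil addr0.
  by rewrite vdetC vdetNl vdetvv !oppr0 eqxx.
have e : vdet b u = - vdet a u.
  have := congr1 (fun v => vdet v u) sum0; rewrite /= vdet_suml vdet0l !big_cons big_nil vdetvv; lra.
have [_ /eqP] := heptagon_at p s7 np sy e; apply.
by rewrite -[RHS]sum0 !big_cons big_nil addr0 addrA.
Qed.

Definition two_pairs s : Prop := exists p q u v w, perm_eq s [:: p; - p; q; - q; u; v; w].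

Definition pair_and_pentagon s : Prop := exists p t,
  [/\ perm_eq s (p :: - p :: t), size t = 5%N & equiv_regular_polygon 5 t].

Lemma count_par_cons2 p t u : (count (par u) t <= count (par u) (p :: - p :: t))%N.
Proof. by rewrite /= addnA leq_addl. Qed.

Lemma classification s : size s = 7%N -> admissible s ->
    {in s, forall u, count (par u) s < 5}%N ->
  [\/ nonpar s /\ {in s, forall u, symm (dets s u)}, two_lines s, two_pairs s | pair_and_pentagon s].
Proof.
move=> s7 cs lt5; have [s0 sum0 gs] := cs.
have [ns|ns] := pselect (opposite_free s).
  have [np|tl] := seven_nonpar s7 cs ns lt5; last by constructor 2.
  constructor 1; split=> //; exact: nonpar_symm.
have [p [t pt]] := opposite_extract s0 ns.
have ct : admissible t by apply: (@admissible_cons2 p); apply: perm_admissible cs.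
have t5 : size t = 5%N by move: s7; rewrite (perm_size pt) => -[].
have lt5' : {in t, forall u, count (par u) t < 5}%N.
  move=> u ut; apply: leq_ltn_trans (lt5 u _); first by rewrite (permP pt) count_par_cons2.
  by rewrite (perm_mem pt) !in_cons ut !orbT.
have [nt|nt] := pselect (opposite_free t).
  have np := five_nonpar t5 ct nt lt5'.
  constructor 4; exists p, t; split=> //; apply: pentagon_of_nonpar => //.
  exact: nonpar_symm.
have [t0 _ _] := ct.
have [q [t' pt']] := opposite_extract t0 nt.
have [u [v [w e]]] : exists u v w, t' = [:: u; v; w].
  by apply: seq_size3; move: t5; rewrite (perm_size pt') => -[].
constructor 3; exists p, q, u, v, w.
by rewrite (permPl pt) !perm_cons (permPl pt') e.
Qed.

End Classification.

(** * Mutual exclusion of the alternatives *)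

Section Exclusion.

Variable R : realType.
Local Notation V := 'cV[R]_2.
Implicit Types (u v w x y p q : V) (s t X Y : seq V).

Lemma vdet_mul (g : 'M[R]_2) u v : vdet (g *m u) (g *m v) = \det g * vdet u v.
Proof. by rewrite /vdet -mul_mx_row det_mulmx. Qed.

Lemma nonpar_image (g : 'M[R]_2) t : nonpar [seq g *m u | u <- t] -> nonpar t.
Proof.
rewrite /nonpar pairwise_map; apply: sub_pairwise => u v /=.
by rewrite vdet_mul mulf_eq0 negb_or => /andP[].
Qed.

Lemma symm_image (g : 'M[R]_2) t u : g \in unitmx ->
  symm (dets [seq g *m u | u <- t] (g *m u)) -> symm (dets t u).
Proof.
rewrite unitmxE unitfE => g0.
have -> : dets [seq g *m u | u <- t] (g *m u) = map ( *%R (\det g)) (dets t u).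
  by rewrite /dets -!map_comp; apply: eq_map => v /=; rewrite vdet_mul.
rewrite /symm; have -> : [seq - d | d <- map ( *%R (\det g)) (dets t u)] =
    map ( *%R (\det g)) [seq - d | d <- dets t u].
  by rewrite -!map_comp; apply: eq_map => d /=; rewrite mulrN.
exact/perm_map_inj/mulfI.
Qed.

Definition polar (r a : R) : V := vec (r * cos a) (r * sin a).

Lemma vdet_polar r a b : vdet (polar r a) (polar r b) = r ^+ 2 * sin (b - a).
Proof. by rewrite vdetE !mxE /= sinB; ring. Qed.

Lemma regular_polygon_polar k r a :
  regular_polygon k r a = [seq polar r (a + turn R k m) | m <- iota 0 k].
Proof. by apply: eq_map => m; apply: col2P; rewrite !mxE. Qed.

Lemma vdet_vertices r a m n : (m <= n)%N ->
  vdet (polar r (a + turn R 5 m)) (polar r (a + turn R 5 n)) = r ^+ 2 * sin (turn R 5 (n - m)).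
Proof.
move=> mn; rewrite vdet_polar; congr (_ * sin _); rewrite /turn natrB //; ring.
Qed.

(** All determinants are multiples of sin(2 pi / 5) and sin(4 pi / 5); at each
    vertex both values occur with both signs. *)
Lemma regular_pentagon_symm r a : 0 < r ->
  nonpar (regular_polygon 5 r a) /\
  {in regular_polygon 5 r a, forall u, symm (dets (regular_polygon 5 r a) u)}.
Proof.
move=> r0; rewrite regular_polygon_polar; have r20 : r ^+ 2 != 0 by rewrite expf_neq0 ?gt_eqF.
have s1 : sin (turn R 5 1) != 0 by rewrite gt_eqF // sin_turn_gt0.
have s2 : sin (turn R 5 2) != 0 by rewrite gt_eqF // sin_turn_gt0.
have s3 : sin (turn R 5 3) = - sin (turn R 5 2) by rewrite -sin_turn_compl.
have s4 : sin (turn R 5 4) = - sin (turn R 5 1) by rewrite -sin_turn_compl.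
pose P m := polar r (a + turn R 5 m).
rewrite [map _ _]/= -![polar r (a + _)]/(P _).
have D m n : (m <= n)%N -> vdet (P m) (P n) = r ^+ 2 * sin (turn R 5 (n - m)) by exact: vdet_vertices.
have D' m n : (m <= n)%N -> vdet (P n) (P m) = - (r ^+ 2 * sin (turn R 5 (n - m))).
  by move=> mn; rewrite vdetC D.
have z : sin (turn R 5 0) = 0 by rewrite turn0 sin0.
split.
  rewrite /= !D // !subSS !subn0 s3 s4 !mulrN !oppr_eq0.
  move: (r ^+ 2) r20 => k k0; rewrite !mulf_eq0 (negPf k0) (negPf s1) (negPf s2) //.
move=> u; rewrite !inE => /or4P[/eqP->|/eqP->|/eqP->|/orP[]/eqP->];
  rewrite /= !vdetvv ?(D 0%N 1%N) ?(D 0%N 2) ?(D 0%N 3) ?(D 0%N 4) ?(D 1%N 2) ?(D 1%N 3) ?(D 1%N 4)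
    ?(D 2 3) ?(D 2 4) ?(D 3 4) ?(D' 0%N 1%N) ?(D' 0%N 2) ?(D' 0%N 3) ?(D' 0%N 4) ?(D' 1%N 2) ?(D' 1%N 3) ?(D' 1%N 4)
    ?(D' 2 3) ?(D' 2 4) ?(D' 3 4) // ?subSS ?subn0 ?s3 ?s4 ?mulrN ?opprK;
  rewrite /symm /= ?opprK ?oppr0; apply/permP => pr /=; ring.
Qed.

Lemma equiv_pentagon_symm t : equiv_regular_polygon 5 t ->
  nonpar t /\ {in t, forall u, symm (dets t u)}.
Proof.
move=> [r [a [r0 [g gU p]]]]; have [np sy] := regular_pentagon_symm a r0.
split; first by apply: (@nonpar_image g); apply: perm_nonpar np; rewrite perm_sym.
move=> u ut; apply: (@symm_image g) => //; rewrite (symm_perm (perm_dets _ p)).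
by apply: sy; rewrite -(perm_mem p) map_f.
Qed.

Lemma perm_split_or_symm s s' : perm_eq s s' -> split_or_symm s' -> split_or_symm s.
Proof.
move=> h gs u; rewrite (perm_mem h) => /gs; rewrite (perm_linesum _ h).
by rewrite (symm_perm (perm_dets u h)).
Qed.

(** A direction parallel to one of the three vectors sees the two others with
    opposite determinants. *)
Lemma triangle_split_or_symm u v w x : u + v + w = 0 ->
  linesum [:: u; v; w] x = 0 \/ symm (dets [:: u; v; w] x).
Proof.
move=> e; have := congr1 (fun z => vdet z x) e; rewrite /= !vdetDl vdet0l => d.
have [ux|ux] := boolP (par x u).
  right; rewrite /= (eqP ux) symm_cons0 (_ : vdet w x = - vdet v x) ?symm_cons2 //.
  by move: d; rewrite (eqP ux); lra.
have [vx|vx] := boolP (par x v).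
  right; have pr : perm_eq [:: v; u; w] [:: u; v; w] by rewrite (perm_catCA [:: v] [:: u]).
  rewrite -(symm_perm (perm_dets x pr)).
  rewrite /= (eqP vx) symm_cons0 (_ : vdet w x = - vdet u x) ?symm_cons2 //.
  by move: d; rewrite (eqP vx); lra.
have [wx|wx] := boolP (par x w).
  right; have pr : perm_eq [:: w; u; v] [:: u; v; w] by rewrite (perm_catC [:: w]).
  rewrite -(symm_perm (perm_dets x pr)).
  rewrite /= (eqP wx) symm_cons0 (_ : vdet v x = - vdet u x) ?symm_cons2 //.
  by move: d; rewrite (eqP wx); lra.
by left; rewrite /linesum !big_cons big_nil (negPf ux) (negPf vx) (negPf wx).
Qed.

Lemma linesum_single s u : nonpar s -> u \in s -> linesum s u = u.
Proof.
move=> /nonparP[us h] uin; rewrite /linesum (perm_big _ (perm_to_rem uin)) big_cons par_refl.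
rewrite big_seq_cond big1; first exact: addr0.
move=> v /andP[vs uv]; move: vs; rewrite mem_rem_uniq // inE => /andP[vu vs].
by have := h u v uin vs; rewrite eq_sym vu uv => /(_ isT).
Qed.

Section TwoPairs.
Variables (s : seq V) (p q u v w : V).
Hypotheses (ps : perm_eq s [:: p; - p; q; - q; u; v; w]) (sum0 : \sum_(v <- s) v = 0).

Lemma two_pairs_sum : u + v + w = 0.
Proof.
by rewrite -[RHS]sum0 (perm_big _ ps) /= !big_cons big_nil addr0 !addNKr addrA.
Qed.

Lemma two_pairs_split_or_symm : split_or_symm s.
Proof.
apply: (perm_split_or_symm ps) => x _; rewrite !linesum_cons2 !symm_dets_cons2.
exact/triangle_split_or_symm/two_pairs_sum.
Qed.

Lemma two_pairs_nonsplitting : vdet u v != 0 -> exists2 x, x \in s & linesum s x != 0.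
Proof.
move=> uv; exists u; first by rewrite (perm_mem ps) !inE eqxx !orbT.
rewrite (perm_linesum _ ps) !linesum_cons2.
have d := congr1 (fun z => vdet z u) two_pairs_sum.
rewrite /= !vdetDl vdet0l vdetvv add0r in d.
have e : vdet w u = vdet u v by rewrite (vdetC u); lra.
rewrite /linesum !big_cons big_nil par_refl /par e (negPf uv) vdetC oppr_eq0 (negPf uv) addr0.
by apply: contra_neq uv => ->; rewrite vdet0l.
Qed.

End TwoPairs.

Section PairPentagon.
Variables (s t : seq V) (p : V).
Hypotheses (ps : perm_eq s (p :: - p :: t)) (np : nonpar t).
Hypotheses (s0 : 0 \notin s).

Lemma pair_pentagon_split_or_symm : {in t, forall u, symm (dets t u)} -> split_or_symm s.
Proof.
move=> sy; apply: (perm_split_or_symm ps) => x _; rewrite linesum_cons2 symm_dets_cons2.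
have [/hasP[u ut xu]|/hasPn h] := boolP (has (par x) t); last first.
  by left; rewrite /linesum big_seq_cond big1 // => v /andP[/h /negbTE ->].
right; have u0 : u != 0.
  by apply: contraNneq s0 => <-; rewrite (perm_mem ps) !in_cons ut !orbT.
have [a ->] := par_scale u0 (eqP (etrans (par_sym u x) xu)).
exact/symm_detsZ/sy.
Qed.

Lemma pair_pentagon_nonsplitting : (0 < size t)%N -> exists2 x, x \in s & linesum s x != 0.
Proof.
case: t ps np => // u t' ps' np' _; have us : u \in s by rewrite (perm_mem ps') !inE eqxx !orbT.
exists u => //; rewrite (perm_linesum _ ps') linesum_cons2 linesum_single ?mem_head //.
by apply: contraNneq s0 => <-.
Qed.

Lemma count_par_nonpar x : x != 0 -> (count (par x) t <= 1)%N.
Proof.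
have t0 u : u \in t -> u != 0.
  by move=> ut; apply: contraNneq s0 => <-; rewrite (perm_mem ps) !in_cons ut !orbT.
move=> x0; case E : (filter (par x) t) => [|y [|z r]]; rewrite -size_filter E //.
have /nonparP[] := np; have : uniq (filter (par x) t) -> y != z.
  by rewrite E /= inE negb_or => /andP[/andP[]].
move=> yz /(filter_uniq (par x))/yz {}yz h.
have : y \in filter (par x) t by rewrite E mem_head.
have : z \in filter (par x) t by rewrite E !inE eqxx orbT.
rewrite !mem_filter => /andP[xz zt] /andP[xy yt].
by have := h y z yt zt yz; rewrite (par_common x0 xy xz).
Qed.

(** Vectors of the pentagon are on distinct lines, so each opposite pair lies on
    the line of p; two pairs would put four vectors on the line of p,
    which carries at most three. *)
Lemma pair_pentagon_not_two_pairs p' q' r :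
  perm_eq s [:: p', - p', q', - q' & r] -> False.
Proof.
move=> ps'; have parN x y : par x (- y) = par x y by rewrite /par vdetNl oppr_eq0.
have cnt x : count (par x) s = (par x p + (par x p + count (par x) t))%N.
  by rewrite (permP ps) /= parN.
have cnt' x : count (par x) s = (par x p' + (par x p' + (par x q' + (par x q' + count (par x) r))))%N.
  by rewrite (permP ps') /= !parN.
have ne x : x \in [:: p', - p', q', - q' & r] -> x != 0.
  by rewrite -(perm_mem ps') => xs; apply: contraNneq s0 => <-.
have p'0 : p' != 0 by apply: ne; rewrite !inE eqxx ?orbT.
have q'0 : q' != 0 by apply: ne; rewrite !inE eqxx ?orbT.
have p0 : p != 0 by apply: contraNneq s0 => <-; rewrite (perm_mem ps) mem_head.
have h x : x != 0 -> x \in [:: p'; q'] -> par p x.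
  move=> x0 xpq; rewrite par_sym; have := cnt x; have := count_par_nonpar x0.
  have := cnt' x; case: (par x p) => //.
  by move: xpq; rewrite !inE => /orP[] /eqP <-; rewrite par_refl => c1 c2 c3;
    exfalso; move: c1 c2 c3 => /=; lia.
have := cnt p; rewrite cnt' par_refl !h ?inE ?eqxx ?orbT //.
by have := count_par_nonpar p0; lia.
Qed.

End PairPentagon.

End Exclusion.

Lemma perm_map_lift (T1 T2 : eqType) (f : T1 -> T2) s t :
  perm_eq (map f s) t -> exists2 s', perm_eq s' s & map f s' = t.
Proof.
elim: t s => [|y t IH] s p; first by case: s p => [|x s] /perm_size // _; exists [::].
have /mapP[x xs yx] : y \in map f s by rewrite (perm_mem p) mem_head.
have px := perm_to_rem xs.
have [|s' ps' es'] := IH (rem x s).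
  by rewrite -(perm_cons y) -(permPr p) yx -map_cons perm_sym perm_map.
exists (x :: s'); last by rewrite /= es' -yx.
by rewrite perm_sym (permPl px) perm_cons perm_sym.
Qed.

(** * From sequences of vectors to index sets *)

Section Indices.

Variables (R : realType) (n : nat) (b : 'I_n -> 'cV[R]_2).
Local Notation V := 'cV[R]_2.
Implicit Types (i j : 'I_n) (J : {set 'I_n}) (P : {set {set 'I_n}}).

Definition vectors : seq V := [seq b i | i : 'I_n].

Lemma mem_vectors i : b i \in vectors. Proof. by rewrite map_f // mem_enum. Qed.

Lemma vectorsP v : reflect (exists i, v = b i) (v \in vectors).
Proof.
apply: (iffP mapP) => [[i _ ->]|[i ->]]; first by exists i.
by exists i; rewrite ?mem_enum.
Qed.

Lemma size_vectors : size vectors = n.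
Proof. by rewrite size_map size_enum_ord. Qed.

Lemma sum_vectors : \sum_(v <- vectors) v = \sum_i b i.
Proof. by rewrite big_map big_enum. Qed.

Lemma sum_image J : \sum_(v <- [seq b j | j in J]) v = \sum_(j in J) b j.
Proof. by rewrite big_map big_enum. Qed.

Lemma perm_enum_setC J : perm_eq (enum 'I_n) (enum J ++ enum (~: J)).
Proof.
apply: uniq_perm; rewrite ?enum_uniq // ?cat_uniq ?enum_uniq ?andbT /=.
  by apply/hasPn => i; rewrite !mem_enum inE.
by move=> i; rewrite mem_cat !mem_enum !inE orbN.
Qed.

Lemma perm_vectors_setC J : perm_eq vectors ([seq b j | j in J] ++ [seq b j | j in ~: J]).
Proof. by rewrite -map_cat; apply/perm_map/perm_enum_setC. Qed.

Lemma in_on_line (u : V) i : u != 0 -> (i \in on_line b <[u]>%VS) = par u (b i).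
Proof.
move=> u0; rewrite inE; apply/vlineP/eqP => [[a ->]|/(par_scale u0)//].
by rewrite vdetZl vdetvv mulr0.
Qed.

Lemma lineE (L : {vspace V}) (u : V) : u != 0 -> \dim L = 1%N -> u \in L -> L = <[u]>%VS.
Proof.
move=> u0 dL uL; apply/esym/eqP; rewrite eqEdim dL dim_vline u0 /= andbT.
exact: uL.
Qed.

Hypothesis b_neq0 : forall i, b i != 0.

Lemma vectors_neq0 : 0 \notin vectors.
Proof. by apply/vectorsP => -[i /esym/eqP]; rewrite (negPf (b_neq0 i)). Qed.

Lemma linesum_vectors i : linesum vectors (b i) = \sum_(j in on_line b <[b i]>%VS) b j.
Proof.
rewrite /linesum big_map big_enum_cond; apply: eq_bigl => j.
by rewrite in_on_line.
Qed.

Lemma cocircuit_on_line i : cocircuit b (on_line b <[b i]>%VS).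
Proof.
split; first by apply/set0Pn; exists i; rewrite in_on_line // par_refl.
by exists <[b i]>%VS; rewrite dim_vline b_neq0.
Qed.

Lemma cocircuit_eq J i : cocircuit b J -> i \in J -> J = on_line b <[b i]>%VS.
Proof.
move=> [_ [L [dL ->]]]; rewrite inE => iL.
by rewrite -(lineE (b_neq0 i) dL).
Qed.

Lemma cocircuitP J : cocircuit b J <-> exists2 i, i \in J & J = on_line b <[b i]>%VS.
Proof.
split=> [cJ|[i _ ->]]; last exact: cocircuit_on_line.
have [/set0Pn[i iJ] _] := cJ; exists i => //; exact: cocircuit_eq.
Qed.

Lemma balancedP J j : J = on_line b <[b j]>%VS ->
  perm_eq [seq vdet (b i) (b j) | i in ~: J] [seq - vdet (b i) (b j) | i in ~: J]
  = symm (dets vectors (b j)).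
Proof.
move=> eJ; rewrite (symm_perm (perm_dets (b j) (perm_vectors_setC J))) /dets map_cat symm_zeros.
  by rewrite /symm -!map_comp.
apply/allP => _ /mapP[_ /mapP[i iJ ->] ->] /=.
by move: iJ; rewrite mem_enum eJ in_on_line.
Qed.

Definition has_nonsplitting_unbalanced : Prop :=
  exists J, [/\ cocircuit b J, ~ splitting b J & ~ balanced b J].

(** Balancedness of a cocircuit is tested at one of its vectors; rescaling carries
    it to every other vector of the same line. *)
Lemma split_or_symmP : ~ has_nonsplitting_unbalanced <-> split_or_symm vectors.
Proof.
split=> [na _ /vectorsP[i ->]|gs [J [/cocircuitP[i iJ eJ] ns nb]]].
  have [|ns] := pselect (splitting b (on_line b <[b i]>%VS)).
    by rewrite /splitting -linesum_vectors; left.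
  right; apply: contrapT => sy; apply: na; exists (on_line b <[b i]>%VS); split => //.
    exact: cocircuit_on_line.
  move=> [j]; rewrite in_on_line // => ij; rewrite (@balancedP _ j); last first.
    apply/setP => k; rewrite !in_on_line //.
    apply/idP/idP => [ik|]; first exact: par_common ij ik.
    by apply: par_common => //; rewrite par_sym.
  move=> syj; apply: sy; have [a ->] : exists a, b i = a *: b j.
    by apply: par_scale => //; apply/eqP; rewrite par_sym in ij.
  exact: symm_detsZ.
have [ls|sy] := gs (b i) (mem_vectors i).
  by apply: ns; rewrite /splitting eJ -linesum_vectors.
by apply: nb; exists i => //; rewrite (balancedP eJ).
Qed.

Hypothesis b_sum0 : nonconfluent b [set: 'I_n].

Lemma sum_vectors0 : \sum_(v <- vectors) v = 0.
Proof.
by rewrite sum_vectors -[RHS]b_sum0; apply: eq_bigl => i; rewrite inE.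
Qed.

Lemma sum_setC J : nonconfluent b J -> nonconfluent b (~: J).
Proof.
rewrite /nonconfluent -!sum_image => e; have := sum_vectors0.
by rewrite (perm_big _ (perm_vectors_setC J)) big_cat /= e add0r.
Qed.

Lemma decomposition_splits P : decomposition b P -> P != set0 -> splits vectors.
Proof.
move=> [/and3P[_ _ P0] dP] /set0Pn[J JP]; have [Jp Js] := dP J JP.
exists [seq b j | j in J], [seq b j | j in ~: J]; split.
- exact: perm_vectors_setC.
- by rewrite -size_eq0 size_map -cardE cards_eq0; apply: contraNneq P0 => <-.
- rewrite -size_eq0 size_map -cardE cards_eq0 -setCT (inj_eq (@setC_inj _)).
  by move: Jp; rewrite properEneq => /andP[].
- by rewrite sum_image.
- by rewrite sum_image; exact: sum_setC.
Qed.

Lemma lift_blocks (ss : seq (seq V)) : perm_eq vectors (flatten ss) ->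
  exists2 es : seq (seq 'I_n), perm_eq (flatten es) (enum 'I_n) & map (map b) es = ss.
Proof.
move=> /perm_map_lift[e pe ee]; exists (reshape (shape ss) e).
  rewrite reshapeKr // -(size_map b) ee size_flatten //.
by rewrite map_reshape ee flattenK.
Qed.

Definition blocks (es : seq (seq 'I_n)) : {set {set 'I_n}} :=
  [set J in [seq [set i in e] | e <- es]].

Lemma uniq_flatten_mem (T : eqType) (es : seq (seq T)) e e' (i : T) : uniq (flatten es) ->
  e \in es -> e' \in es -> i \in e -> i \in e' -> e = e'.
Proof.
elim: es => //= f es IH; rewrite cat_uniq => /and3P[_ /hasPn h ues].
have out e1 : e1 \in es -> i \in e1 -> i \notin f.
  by move=> e1s ie1; apply: h; apply/flattenP; exists e1.
rewrite !in_cons => /orP[/eqP ->|es1] /orP[/eqP ->|es2] // i1 i2.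
- by have := out _ es2 i2; rewrite i1.
- by have := out _ es1 i1; rewrite i2.
- exact: IH.
Qed.

Lemma blocks_decomposition (es : seq (seq 'I_n)) :
    perm_eq (flatten es) (enum 'I_n) -> (1 < size es)%N -> [::] \notin es ->
    {in es, forall e, \sum_(i <- e) b i = 0} ->
  decomposition b (blocks es) /\ #|blocks es| = size es.
Proof.
move=> pe es1 en s0.
have ue : uniq (flatten es) by rewrite (perm_uniq pe) enum_uniq.
have inB J : J \in blocks es -> exists2 e, e \in es & J = [set i in e].
  by rewrite inE => /mapP[e ees ->]; exists e.
have ne e : e \in es -> exists i, i \in e.
  by case: e => [|i e] ees; [rewrite ees in en|exists i; rewrite mem_head].
have uB : uniq [seq [set i in e] | e <- es].
  rewrite map_inj_in_uniq; last first.
    move=> e e' ee e'e /setP eq; have [i ie] := ne e ee.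
    by apply: (uniq_flatten_mem ue ee e'e ie); have := eq i; rewrite !inE ie => /esym.
  elim: (es) ue ne => //= e r IH; rewrite cat_uniq => /and3P[_ /hasPn h ur] ne.
  rewrite IH // ?andbT; last by move=> e' e'r; apply: ne; rewrite in_cons e'r orbT.
  apply/negP => er; have [i ie] := ne e (mem_head _ _).
  by have := h i; rewrite ie => /(_ _)/negP; apply => //; apply/flattenP; exists e.
have cB : #|blocks es| = size es by rewrite cardsE (card_uniqP uB) size_map.
split=> //; split.
  apply/and3P; split.
  - apply/eqP/setP => i; rewrite inE; apply/bigcupP.
    have : i \in flatten es by rewrite (perm_mem pe) mem_enum.
    move=> /flattenP[e ees ie]; exists [set i in e]; last by rewrite inE.
    by rewrite inE map_f.
  - apply/trivIsetP => _ _ /inB[e ee ->] /inB[e' ee' ->]; apply: contraR.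
    rewrite -setI_eq0 => /set0Pn[i]; rewrite !inE => /andP[ie ie'].
    by rewrite (uniq_flatten_mem ue ee ee' ie ie').
  - apply/negP => /inB[e ee /esym/setP h]; have [i ie] := ne e ee.
    by have := h i; rewrite !inE ie.
move=> J JB; have [e ee eJ] := inB J JB; split.
  rewrite properT; apply/eqP => JT.
  have : (1 < #|blocks es|)%N by rewrite cB.
  move=> /card_gt1P[J1 [J2 [/inB[e1 e1e ->] /inB[e2 e2e ->] /negP]]]; apply.
  have al e' : e' \in es -> e' = e.
    move=> e'e; have [i ie'] := ne e' e'e; apply: (uniq_flatten_mem ue e'e ee ie').
    by have : i \in J by [rewrite JT inE]; rewrite eJ inE.
  by rewrite (al e1) // (al e2).
rewrite /nonconfluent eJ -[RHS](s0 e ee).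
have uqe : uniq e.
  elim: (es) ue ee => //= e1 r IH.
  by rewrite cat_uniq in_cons => /and3P[u1 _ u2] /orP[/eqP ->|/IH->].
by rewrite big_uniq //; apply: eq_bigl => i; rewrite inE.
Qed.

End Indices.

(** * Decompositions into prescribed blocks *)

Section Alternatives.

Variables (R : realType) (n : nat) (b : 'I_n -> 'cV[R]_2).
Local Notation V := 'cV[R]_2.
Implicit Types (i j : 'I_n) (J : {set 'I_n}) (P : {set {set 'I_n}}).
Hypothesis b_neq0 : forall i, b i != 0.
Hypothesis b_sum0 : nonconfluent b [set: 'I_n].

Lemma count_par_vectors i : count (par (b i)) (vectors b) = #|on_line b <[b i]>%VS|.
Proof.
rewrite count_map -sum1_count -sum1_card big_enum_cond; apply: eq_bigl => j /=.
by rewrite in_on_line.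
Qed.

Lemma lift_decomposition (ss : seq (seq V)) :
    perm_eq (vectors b) (flatten ss) -> (1 < size ss)%N -> [::] \notin ss ->
    {in ss, forall t, \sum_(v <- t) v = 0} ->
  exists es, [/\ map (map b) es = ss, perm_eq (flatten es) (enum 'I_n),
    decomposition b (blocks es) & #|blocks es| = size ss].
Proof.
move=> /lift_blocks[es pe e] ss1 n0 s0; exists es.
have [| | |d c] := @blocks_decomposition _ _ b es pe.
- by rewrite -(size_map (map b)) e.
- by apply: contra n0 => h; rewrite -e -[[::]]/(map b [::]) map_f.
- by move=> e' e'e; rewrite -(big_map b xpredT id) s0 // -e map_f.
by split=> //; rewrite c -e size_map.
Qed.

Lemma splits_reducible : splits (vectors b) -> reducible b.
Proof.
move=> [s1 [s2 [p n1 n2 z1 z2]]].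
have [| | | |es [_ _ d c]] := @lift_decomposition [:: s1; s2] => //.
- by rewrite /= cats0.
- by rewrite !inE negb_or ![[::] == _]eq_sym n1.
- by move=> t; rewrite !inE => /orP[] /eqP ->.
by exists (blocks es).
Qed.

(** A block contained in a line is the whole cocircuit of this line, because the
    other blocks are on other lines. *)
Lemma lines_decomposition (xss : seq (V * seq V)) :
    perm_eq (vectors b) (flatten [seq z.2 | z <- xss]) -> (1 < size xss)%N ->
    [::] \notin [seq z.2 | z <- xss] ->
    {in [seq z.2 | z <- xss], forall t, \sum_(v <- t) v = 0} ->
    nonpar [seq z.1 | z <- xss] -> {in xss, forall z, z.1 != 0 /\ all (par z.1) z.2} ->
  exists P, [/\ decomposition b P, #|P| = size xss & forall J, J \in P -> cocircuit b J].
Proof.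
move=> p xs1 n0 s0 np lin.
have [|//|//|es [e pe d c]] := lift_decomposition p; first by rewrite size_map.
rewrite size_map in c.
exists (blocks es); split=> // J; rewrite inE => /(nthP set0)[k]; rewrite size_map => ks <-.
have ses : size es = size xss by rewrite -(size_map (map b)) e size_map.
pose z k := nth (0, [::]) xss k.
have ze l : (l < size es)%N -> map b (nth [::] es l) = (z l).2.
  by move=> le; rewrite -(nth_map _ [::]) // e (nth_map (0, [::])) // -ses.
have zP l : (l < size es)%N -> (z l).1 != 0 /\ forall i, i \in nth [::] es l -> par (z l).1 (b i).
  move=> le; have zx : z l \in xss by rewrite mem_nth // -ses.
  have [z0 za] := lin (z l) zx.
  split=> // i ie; apply: (allP za); by rewrite -ze // map_f.
rewrite (nth_map [::]) //; have [zk0 zk] := zP k ks.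
have [i ie] : exists i, i \in nth [::] es k.
  have : nth [::] es k != [::].
    apply: contraNneq n0 => h; have := ze k ks; rewrite h /= => ->.
    by rewrite map_f // mem_nth // -ses.
  by case: (nth [::] es k) => // i r _; exists i; rewrite mem_head.
apply/(cocircuitP b_neq0); exists i; first by rewrite inE.
apply/setP => j; rewrite inE in_on_line //; apply/idP/idP => [je|ij].
  exact: par_common zk0 (zk i ie) (zk j je).
have : j \in flatten es by rewrite (perm_mem pe) mem_enum.
move=> /flattenP[e' /(nthP [::])[l ls <-] jl].
have [zl0 zl] := zP l ls; have [<- //|kl] := eqVneq l k; exfalso.
have /nonparP[u h] := np.
have : ~~ par (z l).1 (z k).1.
  have zz m : (m < size es)%N -> (z m).1 = nth 0 [seq z.1 | z <- xss] m.
    by move=> ms; rewrite (nth_map (0, [::])) // -ses.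
  rewrite !zz //; apply: h; rewrite ?mem_nth ?size_map -?ses //.
  by rewrite nth_uniq ?size_map -?ses.
move=> /negP; apply; apply: (@par_common _ (b j)) => //.
  by rewrite par_sym; exact: zl.
rewrite par_sym; apply: (@par_common _ (b i)) ij => //.
by rewrite par_sym; exact: zk.
Qed.

Lemma perm_enum_block (e : seq (ordinal n)) : uniq e -> perm_eq (enum [set i in e]) e.
Proof.
move=> ue; apply: uniq_perm; rewrite ?enum_uniq // => i.
by rewrite mem_enum inE.
Qed.

Lemma cocircuits_splitting P : decomposition b P -> (forall J, J \in P -> cocircuit b J) ->
  {in vectors b, forall v, linesum (vectors b) v = 0}.
Proof.
move=> [/and3P[/eqP cP _ _] dP] co _ /vectorsP[i ->].
have : i \in cover P by rewrite cP inE.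
move=> /bigcupP[J JP iJ]; rewrite linesum_vectors // -(cocircuit_eq b_neq0 (co J JP) iJ).
by have [] := dP J JP.
Qed.

Lemma generates_pair J u v w :
  perm_eq [seq b j | j in J] [:: u; v; w] -> vdet u v != 0 -> generates b J.
Proof.
move=> p uv; apply/vspaceP => z; rewrite memvf.
have -> : z = (vdet u v)^-1 *: (vdet z v *: u + vdet u z *: v).
  by rewrite -cramer scalerA mulVf // scale1r.
by rewrite memvZ // memvD // memvZ // memv_span // (perm_mem p) !inE eqxx ?orbT.
Qed.

Lemma generates_not_par J u v w : perm_eq [seq b j | j in J] [:: u; v; w] -> u != 0 ->
  u + v + w = 0 -> generates b J -> vdet u v != 0.
Proof.
move=> p u0 e gJ; apply/eqP => uv.
have vu : v \in <[u]>%VS by have [|a ->] := par_scale u0 (v := v);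
    [rewrite vdetC uv oppr0|rewrite memvZ ?memv_line].
have wu : w \in <[u]>%VS.
  have -> : w = - (u + v) by apply/eqP; rewrite -addr_eq0 addrC e.
  by rewrite memvN memvD ?memv_line.
have : (fullv <= <[u]>)%VS.
  rewrite -gJ; apply/span_subvP => z; rewrite (perm_mem p) !inE => /or3P[] /eqP -> //.
  exact: memv_line.
by move=> /dimvS; rewrite dim_vline u0 dimvf /dim /=.
Qed.

End Alternatives.

(** * The alternatives for seven indexed vectors *)

Section SevenVectors.

Variables (R : realType) (b : 'I_7 -> 'cV[R]_2).
Local Notation V := 'cV[R]_2.
Implicit Types (i j : 'I_7) (J : {set 'I_7}) (P : {set {set 'I_7}}).

Definition splits_into_cocircuits : Prop :=
  exists P, [/\ decomposition b P, #|P| = 3%N \/ #|P| = 2%N & forall J, J \in P -> cocircuit b J].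

Definition splits_with_triangle : Prop :=
  exists P, [/\ decomposition b P, #|P| = 3%N & exists J, [/\ J \in P, #|J| = 3%N & generates b J]].

Definition splits_with_pentagon : Prop :=
  exists J1 J2 : {set 'I_7}, [/\ J1 != J2, decomposition b [set J1; J2], opposite_pair b J1
    & equiv_regular_polygon 5 [seq b j | j in J2]].

Hypothesis b_neq0 : forall i, b i != 0.
Hypothesis b_sum0 : nonconfluent b [set: 'I_7].
Hypothesis b_lines : forall L : {vspace V}, \dim L = 1%N -> (#|on_line b L| < 5)%N.

Let s := vectors b.

Lemma count_par_lt5 : {in s, forall u, count (par u) s < 5}%N.
Proof.
move=> _ /vectorsP[i ->]; rewrite count_par_vectors //; apply: b_lines.
by rewrite dim_vline b_neq0.
Qed.

Lemma two_lines_cocircuits : two_lines s -> splits_into_cocircuits.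
Proof.
move=> [x [y [X [Y [p pX pY xy [sX sY]]]]]].
have x0 : x != 0 by apply: contraNneq (vectors_neq0 b_neq0) => <-; rewrite (perm_mem p) mem_head.
have y0 : y != 0.
  by apply: contraNneq (vectors_neq0 b_neq0) => <-; rewrite (perm_mem p) mem_cat mem_head orbT.
have [| | | | | |P [d c co]] := @lines_decomposition _ _ b b_neq0 [:: (x, x :: X); (y, y :: Y)] => //.
- by rewrite /= cats0.
- by move=> t; rewrite !inE => /orP[] /eqP ->.
- by rewrite /= andbT /= -/(par y x) par_sym xy.
- by move=> z; rewrite !inE => /orP[] /eqP -> /=; rewrite par_refl.
by exists P; split=> //; right.
Qed.

(** The three vectors outside the pairs sum to zero.  If they are collinear, the
    bound on the size of a line keeps p and q off their line, and the lines of
    the configuration are two or three, depending on whether p and q are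
    parallel. *)
Lemma two_pairs_classification : two_pairs s -> splits_into_cocircuits \/ splits_with_triangle.
Proof.
move=> [p [q [u [v [w ps]]]]].
have sum0 : \sum_(v <- s) v = 0 by exact: sum_vectors0.
have e := two_pairs_sum ps sum0.
have s0 := vectors_neq0 b_neq0.
have ne z : z \in [:: p; - p; q; - q; u; v; w] -> z != 0.
  by rewrite -(perm_mem ps) => zs; apply: contraNneq s0 => <-.
have [p0 q0 u0] : [/\ p != 0, q != 0 & u != 0] by split; apply: ne; rewrite !inE eqxx ?orbT.
have [uv|uv] := boolP (vdet u v == 0); last first.
  right; have [| | | |es [ee pe d c]] := @lift_decomposition _ _ b
    [:: [:: u; v; w]; [:: p; - p]; [:: q; - q]].
  - by rewrite (permPl ps) /= (perm_catC [:: p; - p; q; - q] [:: u; v; w]).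
  - by [].
  - by [].
  - by move=> t; rewrite !inE => /or3P[] /eqP ->; rewrite !big_cons big_nil addr0 ?addrN // addrA.
  exists (blocks es); split=> //.
  case: es ee pe d c => [|e1 es] // [m1 _] pe d c.
  have ue1 : uniq e1.
    have : uniq (flatten (e1 :: es)) by rewrite (perm_uniq pe) enum_uniq.
    by rewrite /= cat_uniq => /and3P[].
  exists [set i in e1]; split.
  - by rewrite inE /= mem_head.
  - by rewrite cardsE (card_uniqP ue1) -(size_map b) m1.
  apply: (@generates_pair _ _ b _ u v w) => //.
  by rewrite -m1; apply: perm_map; exact: perm_enum_block.
left; have vu : par u v by rewrite par_sym.
have wu : par u w.
  have := congr1 (fun z => vdet z u) e; rewrite /= !vdetDl vdet0l vdetvv (eqP vu) !add0r => /eqP.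
  by [].
have parN x y : par x (- y) = par x y by rewrite /par vdetNl oppr_eq0.
have us : u \in s by rewrite (perm_mem ps) !inE eqxx !orbT.
have := count_par_lt5 us; rewrite (permP ps) /= !parN par_refl vu wu.
have [up|up] := boolP (par u p); first by case: (par u q).
have [uq|uq] := boolP (par u q); first by [].
move=> _.
have [pq|pq] := boolP (par p q).
  apply: two_lines_cocircuits; exists p, u, [:: - p; q; - q], [:: v; w]; split.
  - by rewrite (permPl ps).
  - by rewrite /= !parN par_refl pq.
  - by rewrite /= vu wu.
  - by rewrite par_sym.
  - by rewrite !big_cons !big_nil !addr0 addNKr addrN addrA.
have [| | | | | |P [d c co]] := @lines_decomposition _ _ b b_neq0
  [:: (u, [:: u; v; w]); (p, [:: p; - p]); (q, [:: q; - q])] => //.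
- by rewrite (permPl ps) /= (perm_catC [:: p; - p; q; - q] [:: u; v; w]).
- by move=> t; rewrite !inE => /or3P[] /eqP ->; rewrite !big_cons big_nil addr0 ?addrN // addrA.
- by rewrite /= !andbT -/(par p u) -/(par q u) -/(par q p) !(par_sym _ u) (par_sym q) up uq pq.
- by move=> z; rewrite !inE => /or3P[] /eqP -> /=; rewrite ?parN ?par_refl ?vu ?wu.
by exists P; split=> //; left.
Qed.

Lemma pair_and_pentagon_splits : pair_and_pentagon s -> splits_with_pentagon.
Proof.
move=> [p [t [ps t5 et]]].
have sum0 : \sum_(v <- s) v = 0 by exact: sum_vectors0.
have [| | | |es [ee pe d c]] := @lift_decomposition _ _ b [:: [:: p; - p]; t].
- by rewrite (permPl ps) /= cats0.
- by [].
- by rewrite !inE negb_or /=; case: (t) t5.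
- move=> r; rewrite !inE => /orP[] /eqP ->; first by rewrite !big_cons big_nil addr0 addrN.
  by rewrite -[RHS]sum0 (perm_big _ ps) /= !big_cons addNKr.
case: es ee pe d c => [|e1 [|e2 [|]]] // [m1 m2] pe d c.
have : uniq (e1 ++ e2) by rewrite -[e2]cats0 (perm_uniq pe) enum_uniq.
rewrite cat_uniq => /and3P[u1 u12 u2].
exists [set i in e1], [set i in e2].
have eB : blocks [:: e1; e2] = [set [set i in e1]; [set i in e2]].
  by apply/setP => J; rewrite !inE.
rewrite eB in d c; split=> //.
- by move: c; rewrite cards2; case: eqP.
- case: e1 m1 u1 {pe d c u12 eB} => [|i [|j [|]]] // [bi bj]; rewrite /= inE andbT => ij.
  exists i, j; split=> //; first by apply/setP => k; rewrite !inE.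
  by rewrite bj opprK.
apply: perm_equiv_regular_polygon et; rewrite -m2 perm_sym.
by apply: perm_map; exact: perm_enum_block.
Qed.

Lemma alternatives_exhaustive : split_or_symm s ->
  [\/ [/\ irreducible b, forall J, cocircuit b J -> balanced b J
       & equiv_regular_polygon 7 s],
      reducible b /\ splits_into_cocircuits,
      reducible b /\ splits_with_triangle |
      reducible b /\ splits_with_pentagon].
Proof.
move=> gs.
have cs : admissible s by split; [exact: vectors_neq0|exact: sum_vectors0|].
have s7 : size s = 7%N by exact: size_vectors.
have red P : decomposition b P -> (1 < #|P|)%N -> reducible b.
  move=> d P1; apply: splits_reducible; apply: (decomposition_splits b_sum0 d).
  by rewrite -card_gt0 (ltnW P1).
have redc : splits_into_cocircuits -> reducible b by move=> [P [d c _]]; apply: red d _; case: c => ->.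
have redd : splits_with_triangle -> reducible b by move=> [P [d c _]]; apply: red d _; rewrite c.
have rede : splits_with_pentagon -> reducible b.
  by move=> [J1 [J2 [ne d _ _]]]; apply: red d _; rewrite cards2 ne.
have [[np sy]|/two_lines_cocircuits c|/two_pairs_classification[c|c]|/pair_and_pentagon_splits c]
  := classification s7 cs count_par_lt5; last 4 first.
- by constructor 2; split; [exact: redc|].
- by constructor 2; split; [exact: redc|].
- by constructor 3; split; [exact: redd|].
- by constructor 4; split; [exact: rede|].
constructor 1; split.
- move=> [P [d P2]]; apply: (heptagon_not_splits s7 np sy).
  by apply: (decomposition_splits b_sum0 d); rewrite -card_gt0 P2.
- move=> J /(cocircuitP b_neq0)[i iJ eJ]; exists i => //.
  by rewrite (balancedP b_neq0 eJ); apply: sy; exact: mem_vectors.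
- exact: heptagon_of_nonpar.
Qed.

(** A single nonzero vector does not sum to zero. *)
Lemma block_gt1 P J : decomposition b P -> J \in P -> (1 < #|J|)%N.
Proof.
move=> [/and3P[_ _ P0] dP] JP; have [_ sJ] := dP J JP.
have J0 : J != set0 by apply: contraNneq P0 => <-.
rewrite ltn_neqAle card_gt0 J0 andbT eq_sym; apply/negP => /cards1P[i eJ].
by move: sJ; rewrite /nonconfluent eJ big_set1; apply/eqP.
Qed.

Lemma pair_image J : #|J| = 2%N -> nonconfluent b J -> exists p, [seq b j | j in J] = [:: p; - p].
Proof.
rewrite cardE => /seq_size2[i [j e]]; rewrite /nonconfluent -sum_image /image_mem e.
rewrite !big_cons big_nil addr0 => /eqP; rewrite addrC addr_eq0 => /eqP ji.
by exists (b i); rewrite /= ji.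
Qed.

(** The two other blocks have four vectors together and at least two each, so both
    are opposite pairs. *)
Lemma triangle_two_pairs : splits_with_triangle -> exists p q u v w,
  perm_eq s [:: p; - p; q; - q; u; v; w] /\ vdet u v != 0.
Proof.
move=> [P [d P3 [J [JP J3 gJ]]]].
have : #|P :\ J| == 2%N by have := cardsD1 J P; rewrite JP P3 add1n => -[<-].
move=> /cards2P[K1 [K2 [K12 eP]]].
have [K1P K2P] : K1 \in P :\ J /\ K2 \in P :\ J by rewrite eP !inE !eqxx orbT.
move: K1P K2P; rewrite !in_setD1 => /andP[K1J K1P] /andP[K2J K2P].
have ePJ : P = [set J; K1; K2] by rewrite -(setD1K JP) eP setUA.
have [pP dP] := d.
have c7 : (#|J| + (#|K1| + #|K2|))%N = 7.
  rewrite -[RHS]card_ord -cardsT (card_partition pP) (big_setD1 J JP) /= eP.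
  by rewrite big_setU1 ?inE // big_set1.
have := block_gt1 d K1P; have := block_gt1 d K2P; rewrite J3 in c7 => k2 k1.
have [c1 c2] : #|K1| = 2%N /\ #|K2| = 2%N by lia.
have [p e1] := pair_image c1 (dP _ K1P).2.
have [q e2] := pair_image c2 (dP _ K2P).2.
have [u [v [w e3]]] : exists u v w, [seq b j | j in J] = [:: u; v; w].
  by apply: seq_size3; rewrite size_map -cardE.
have /and3P[/eqP cP /trivIsetP tP _] := pP.
have dis A B : A \in P -> B \in P -> A != B -> {in enum B, forall i, i \notin enum A}.
  move=> AP BP AB i; rewrite !mem_enum => iB; apply/negP => iA.
  by have := tP A B AP BP AB; rewrite -setI_eq0 => /eqP/setP/(_ i); rewrite !inE iA iB.
have pe : perm_eq (enum 'I_7) (enum K1 ++ enum K2 ++ enum J).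
  apply: uniq_perm; first exact: enum_uniq.
    rewrite !cat_uniq !enum_uniq /= andbT; apply/andP; split; apply/hasPn => i.
      by rewrite mem_cat => /orP[]; [exact: dis|apply: dis].
    by apply: dis.
  move=> i; rewrite !mem_cat !mem_enum inE; apply/esym.
  have : i \in cover P by rewrite cP inE.
  by rewrite ePJ => /bigcupP[A]; rewrite !inE => /orP[/orP[]|] /eqP -> ->; rewrite ?orbT.
exists p, q, u, v, w; split.
  have := perm_map b pe; rewrite !map_cat.
  by rewrite -[map b (enum K1)]/[seq b j | j in K1] e1 -[map b (enum K2)]/[seq b j | j in K2] e2
     -[map b (enum J)]/[seq b j | j in J] e3.
apply: (@generates_not_par _ _ b J u v w) => //.
- by rewrite e3.
- have : u \in [seq b j | j in J] by rewrite e3 mem_head.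
  by move=> /mapP[i _ ->].
- by have := (dP _ JP).2; rewrite /nonconfluent -sum_image e3 !big_cons big_nil addr0 addrA.
Qed.

Lemma pentagon_pair : splits_with_pentagon -> pair_and_pentagon s.
Proof.
move=> [J1 [J2 [ne [pP _] [i [j [ij eJ1 bij]]] et]]].
have /and3P[/eqP cP /trivIsetP tP _] := pP.
have eJ2 : J2 = ~: J1.
  apply/setP => k; rewrite inE.
  have := tP J1 J2; rewrite !inE !eqxx orbT => /(_ isT isT ne).
  rewrite -setI_eq0 => /eqP/setP/(_ k); rewrite !inE.
  have : k \in cover [set J1; J2] by rewrite cP inE.
  move=> /bigcupP[A]; rewrite !inE => /orP[] /eqP -> ->; first by move=> /= ->.
  by rewrite andbT => ->.
have p := perm_vectors_setC b J1.
have pJ1 : perm_eq [seq b k | k in J1] [:: b j; - b j].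
  rewrite -bij -[[:: b j; b i]]/(map b [:: j; i]); apply: perm_map.
  apply: uniq_perm; rewrite ?enum_uniq //= ?inE ?andbT 1?eq_sym // => k.
  by rewrite mem_enum eJ1 !inE orbC.
have p' : perm_eq s (b j :: - b j :: [seq b k | k in J2]).
  by rewrite (permPl p) -eJ2 (perm_cat2r _ _ [:: b j; - b j]).
exists (b j), [seq b k | k in J2]; split=> //.
by have := perm_size p'; rewrite size_vectors => -[].
Qed.

End SevenVectors.

Lemma exactly_one_of_five (A B C D E : Prop) :
    [\/ A, B, C | D \/ E] -> ~ (A /\ B) -> ~ (A /\ C) -> ~ (A /\ D) -> ~ (A /\ E) ->
    ~ (B /\ C) -> ~ (B /\ D) -> ~ (B /\ E) -> ~ (C /\ D) -> ~ (C /\ E) -> ~ (D /\ E) ->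
  exactly_one [:: A; B; C; D; E].
Proof.
move=> h; rewrite /exactly_one /= => *.
by case: h => [h|h|h|[h|h]]; [exists 0%N|exists 1%N|exists 2|exists 3|exists 4];
  split=> // -[|[|[|[|[|[|k]]]]]] //= h'; exfalso; tauto.
Qed.

Theorem theorem2p8 (R : realType) (b : 'I_7 -> 'cV[R]_2)
  (b_neq0 : forall i, b i != 0)
  (b_nonconfluent : nonconfluent b [set: 'I_7])
  (b_lines : forall L : {vspace 'cV[R]_2},
     \dim L = 1%N -> (#|on_line b L| < 5)%N) :
  exactly_one
    [:: (* a *) exists J, [/\ cocircuit b J, ~ splitting b J & ~ balanced b J];
        (* b *) irreducible b /\ (forall J, cocircuit b J -> balanced b J);
        (* c *) reducible b /\
                exists P : {set {set 'I_7}},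
                  [/\ decomposition b P,
                      #|P| = 3%N \/ #|P| = 2%N
                    & forall J, J \in P -> cocircuit b J];
        (* d *) reducible b /\
                exists P : {set {set 'I_7}},
                  [/\ decomposition b P,
                      #|P| = 3%N
                    & exists J, [/\ J \in P, #|J| = 3%N & generates b J]];
        (* e *) reducible b /\
                exists J1 J2 : {set 'I_7},
                  [/\ J1 != J2,
                      decomposition b [set J1; J2],
                      opposite_pair b J1
                    & equiv_regular_polygon 5 [seq b j | j in J2]]]
  /\ (irreducible b /\ (forall J, cocircuit b J -> balanced b J) ->
      equiv_regular_polygon 7 [seq b i | i : 'I_7]).
Proof.
have s0 := vectors_neq0 b_neq0; have sum0 := sum_vectors0 b_nonconfluent.
have na_good := split_or_symmP b_neq0.
have c_split : splits_into_cocircuits b -> {in vectors b, forall v, linesum (vectors b) v = 0}.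
  by move=> [P [d _ co]]; exact: cocircuits_splitting d co.
have c_good : splits_into_cocircuits b -> split_or_symm (vectors b).
  by move=> /c_split h v /h; left.
have d_good : splits_with_triangle b -> split_or_symm (vectors b).
  by move=> /(triangle_two_pairs b_neq0)[p [q [u [v [w [ps _]]]]]]; exact: two_pairs_split_or_symm ps sum0.
have d_ns : splits_with_triangle b -> exists2 x, x \in vectors b & linesum (vectors b) x != 0.
  move=> /(triangle_two_pairs b_neq0)[p [q [u [v [w [ps uv]]]]]].
  exact: two_pairs_nonsplitting ps sum0 uv.
have e_good : splits_with_pentagon b -> split_or_symm (vectors b).
  move=> /pentagon_pair[p [t [ps _ /equiv_pentagon_symm[np sy]]]].
  exact: pair_pentagon_split_or_symm ps s0 sy.
have e_ns : splits_with_pentagon b -> exists2 x, x \in vectors b & linesum (vectors b) x != 0.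
  move=> /pentagon_pair[p [t [ps t5 /equiv_pentagon_symm[np sy]]]].
  by apply: (pair_pentagon_nonsplitting ps np s0); rewrite t5.
have cns : splits_into_cocircuits b ->
    (exists2 x, x \in vectors b & linesum (vectors b) x != 0) -> False.
  by move=> /c_split h [x /h ->]; rewrite eqxx.
have ex := alternatives_exhaustive b_neq0 b_nonconfluent b_lines.
split.
  apply: exactly_one_of_five.
  - have [a|/na_good/ex[[irr bal _]|c|d|e]] := pselect (has_nonsplitting_unbalanced b).
    + by constructor 1.
    + by constructor 2.
    + by constructor 3.
    + by constructor 4; left.
    + by constructor 4; right.
  - by move=> [[J [cJ _ nb]] [_ bal]]; exact/nb/bal.
  - by move=> [a [_ /c_good/na_good]].
  - by move=> [a [_ /d_good/na_good]].
  - by move=> [a [_ /e_good/na_good]].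
  - by move=> [[irr _] [r _]].
  - by move=> [[irr _] [r _]].
  - by move=> [[irr _] [r _]].
  - by move=> [[_ c] [_ /d_ns]]; exact: cns.
  - by move=> [[_ c] [_ /e_ns]]; exact: cns.
  - move=> [[_ /(triangle_two_pairs b_neq0)[p [q [u [v [w [ps _]]]]]]]
      [_ /pentagon_pair[p' [t [pt _ /equiv_pentagon_symm[np _]]]]]].
    exact: (pair_pentagon_not_two_pairs pt np s0 ps).
move=> [irr bal]; have /na_good/ex[[_ _ //]|[/irr]|[/irr]|[/irr]] // : ~ has_nonsplitting_unbalanced b.
by move=> [J [cJ _ nb]]; exact/nb/bal.
Qed.
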